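(* (1) A local model surface $(X,\omega)$ is uniquely determined, up to isomorphism, by its associated lamination and the heights of its inner and outer annuli; that is, two local model surfaces whose associated finite laminations are equivalent, whose outer annuli have equal heights and whose inner annuli have equal heights are isomorphic. (2) A local model map (branched covering) $(Y,\eta)\to(X,\omega)$ is uniquely determined, up to post-composition by an isomorphism of $(X,\omega)$, by the data consisting of the lamination associated to $(Y,\eta)$, the heights of the inner and outer annuli of $(Y,\eta)$, and the degree; that is, if $f:(Y,\eta)\to(X,\omega)$ and $f':(Y',\eta')\to(X',\omega')$ are local model maps of the same degree and $\beta:(Y,\eta)\to(Y',\eta')$ is an isomorphism (which exists whenever the laminations of $Y,Y'$ are equivalent and their annuli have equal heights), then there is an isomorphism $\alpha:(X,\omega)\to(X',\omega')$ with $f'\circ\beta=\alpha\circ f$.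
   Context: Local model surface. Let $-\infty\le h_{min}<c_0<h_{max}\le\infty$ and let $R=\{x+iy: 0<x<2\pi,\ h_{min}<y<h_{max}\}\setminus\Sigma$, where $\Sigma$ is a finite (possibly empty) union of vertical slits $\{x+iy: x=x_j,\ h_{min}<y\le c_0\}$. A local model surface is a pair $(X,\omega)$ where $X$ is a planar Riemann surface obtained from $R$ by identifying pairs of vertical edges by horizontal translations, and $\omega$ is the holomorphic $1$-form given by $dz$ on $R$. The $y$-coordinate induces a height function $h:X\to\mathbb{R}$ (defined up to an additive constant by $(X,\omega)$). The central leaf is $L_X=\{h=c_0\}$; it contains all zeros of $\omega$. The complement $X\setminus L_X$ is the disjoint union of one outer annulus $\{h>c_0\}$, of height $h_{max}-c_0$, and finitely many inner annuli (the components of $\{h<c_0\}$), each of height $c_0-h_{min}$. A local model map (or local model) is a holomorphic branched cover $f:(Y,\eta)\to(X,\omega)$ between local model surfaces such that $\eta=\frac{1}{\deg f}f^*\omega$ and $f$ sends the central leaf of $Y$ to the central leaf of $X$. An isomorphism is a degree $1$ local model map. Laminations. A finite lamination is an equivalence relation on an oriented circle $C$ isometric to $\mathbb{R}/2\pi\mathbb{Z}$ such that each class is finite, all but finitely many classes are single points, and classes are unlinked (if $\{a,b\}$ and $\{c,e\}$ lie in distinct classes then $a,b$ lie in the same component of $C\setminus\{c,e\}$). Two finite laminations are equivalent if an orientation-preserving isometry of the circles takes one to the other. The lamination associated to $(X,\omega)$: the form $\omega$ gives the central leaf $L_X$ an orientation and length function making it the quotient of an oriented circle of length $2\pi$ (the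 bottom boundary circle of the outer annulus) by a finite lamination. *)

(* Defs.v *)
From HB Require Import structures.
From Stdlib Require Import Relation_Operators.
From mathcomp Require Import all_boot all_order all_algebra perm complex.
From mathcomp Require Import all_classical all_reals all_analysis.

Set Implicit Arguments.
Unset Strict Implicit.
Unset Printing Implicit Defensive.

Import Order.TTheory GRing.Theory Num.Theory numFieldNormedType.Exports.
Local Open Scope classical_set_scope.
Local Open Scope ring_scope.
Local Open Scope complex_scope.

(* [R[i]^o] is the complex plane as a normed space over itself, so that
   [derivable g w 1] and [is_derive w 1 g a] refer to complex derivatives. *)

Section RiemannSurfaces.
Variable R : realType.
Local Notation C := ((R[i])^o).

Record chart (T : topologicalType) := Chart {
  chart_dom : set T;
  chart_map :> T -> C (* only meaningful on [chart_dom] *)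
}.

(* A homeomorphism from an open set onto an open subset of the plane. *)
Definition is_chart (T : topologicalType) (c : chart T) : Prop :=
  [/\ open (chart_dom c),
      set_inj (chart_dom c) c,
      forall V : set C, open V -> open (chart_dom c `&` c @^-1` V) &
      forall A : set T, open A -> A `<=` chart_dom c -> open (c @` A : set C)].

(* [u] is, near [p], a holomorphic function of the coordinate [c]. *)
Definition holo_fun_at (T : topologicalType) (c : chart T) (u : T -> C)
    (p : T) : Prop :=
  exists g : C -> C, (\forall p' \near p, u p' = g (c p')) /\
                     (\forall w \near c p, derivable g w 1).

(* [du = a dc] at [p]. *)
Definition deriv_in (T : topologicalType) (c : chart T) (u : T -> C)
    (p : T) (a : C) : Prop :=
  exists g : C -> C, (\forall p' \near p, u p' = g (c p')) /\
                     is_derive (c p) 1 g a.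

Definition compatible (T : topologicalType) (c c' : chart T) : Prop :=
  forall p, chart_dom c p -> chart_dom c' p ->
    holo_fun_at c c' p /\ holo_fun_at c' c p.

(* Second countability is automatic, by Rado's theorem. *)
Record riemann_surface := RiemannSurface {
  rs_top :> topologicalType;
  rs_atlas : set (chart rs_top);
  rs_chart : forall c, rs_atlas c -> is_chart c;
  rs_cover : forall p, exists2 c, rs_atlas c & chart_dom c p;
  rs_compat : forall c c', rs_atlas c -> rs_atlas c' -> compatible c c';
  rs_connected : connected [set: rs_top];
  rs_hausdorff : hausdorff_space rs_top
}.

(* A holomorphic coordinate, i.e. a member of the maximal atlas. *)
Definition coordinate (X : riemann_surface) (c : chart X) : Prop :=
  is_chart c /\ forall c', rs_atlas c' -> compatible c c'.

(* Planar (schlichtartig): every Jordan curve separates the surface. *)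
Definition planar (X : riemann_surface) : Prop :=
  forall gamma : R -> X,
    {within `[0, 1], continuous gamma} ->
    gamma 0 = gamma 1 ->
    set_inj `[0, 1[ gamma ->
    ~ connected (~` (gamma @` `[0, 1])).

Definition holomorphic (X Y : riemann_surface) (f : X -> Y) : Prop :=
  continuous f /\
  forall c c' p, rs_atlas c -> rs_atlas c' ->
    chart_dom c p -> chart_dom c' (f p) -> holo_fun_at c (c' \o f) p.

(* A 1-form is given by its coefficients: [omega c p] is the coefficient at
   [p] with respect to [dc], for [c] in the atlas and [p] in its domain. *)
Definition form (X : riemann_surface) := chart X -> X -> C.

Definition holomorphic_form (X : riemann_surface) (omega : form X) : Prop :=
  (forall c p, rs_atlas c -> chart_dom c p -> holo_fun_at c (omega c) p) /\
  (forall c c' p a, rs_atlas c -> rs_atlas c' ->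
     chart_dom c p -> chart_dom c' p ->
     deriv_in c c' p a -> omega c p = omega c' p * a).

(* [omega = du] on [U]. *)
Definition is_differential (X : riemann_surface) (omega : form X)
    (U : set X) (u : X -> C) : Prop :=
  forall c p, rs_atlas c -> chart_dom c p -> U p -> deriv_in c u p (omega c p).

(* [eta = s f^* omega]. *)
Definition is_scaled_pullback (Y X : riemann_surface) (s : C) (f : Y -> X)
    (eta : form Y) (omega : form X) : Prop :=
  forall c c' p a, rs_atlas c -> rs_atlas c' ->
    chart_dom c p -> chart_dom c' (f p) ->
    deriv_in c (c' \o f) p a -> eta c p = s * (omega c' (f p) * a).

Definition disk (r : R) : set C := [set w | `|w| < r%:C].

(* Every point has a disk neighborhood whose preimage is a disjoint union of
   disks on which [f] is, in suitable holomorphic coordinates, [w |-> w ^+ k];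
   the degree is the sum of the exponents. *)
Definition branched_cover (Y X : riemann_surface) (d : nat) (f : Y -> X) :
    Prop :=
  holomorphic f /\
  forall x : X, exists (c : chart X) (r : R) (m : nat)
      (b : 'I_m -> chart Y) (rho : 'I_m -> R) (k : 'I_m -> nat),
    [/\ [/\ coordinate c, chart_dom c x, c x = 0 &
            c @` chart_dom c = disk r],
        forall j, [/\ coordinate (b j), b j @` chart_dom (b j) = disk (rho j),
                      0 < rho j, (0 < k j)%N &
                      forall y, chart_dom (b j) y -> c (f y) = b j y ^+ k j],
        f @^-1` chart_dom c = \bigcup_(j in [set: 'I_m]) chart_dom (b j),
        trivIset [set: 'I_m] (fun j => chart_dom (b j)) &
        (\sum_(j < m) k j)%N = d].

End RiemannSurfaces.

Section LocalModels.
Variable R : realType.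
Local Notation C := ((R[i])^o).

(* The rectangle [0 < x < 2 pi, hmin < y < hmax] with [slit_num] vertical
   slits going up to height [c0]. The slits are at the abscissas [node j] for
   [0 < j < slit_num + 1]; the two extreme nodes are the sides. *)
Record slit_rectangle := SlitRectangle {
  slit_num : nat;
  hmin : \bar R;
  hmax : \bar R;
  c0 : R;
  node : 'I_slit_num.+2 -> R;
  hmin_c0 : (hmin < c0%:E)%E;
  c0_hmax : (c0%:E < hmax)%E;
  node_first : node ord0 = 0;
  node_last : node ord_max = 2 * pi;
  node_incr : forall i j : 'I_slit_num.+2, (i < j)%N -> node i < node j
}.

Definition left_node (D : slit_rectangle) (i : 'I_(slit_num D).+1) : R :=
  node (widen_ord (leqnSn _) i).
Definition right_node (D : slit_rectangle) (i : 'I_(slit_num D).+1) : R :=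
  node (lift ord0 i).

(* The slit lines, prolonged up to height [hmax], cut the slit rectangle into
   columns; here column [i] includes both of its vertical sides. *)
Definition column (D : slit_rectangle) (i : 'I_(slit_num D).+1) : set C :=
  [set z | left_node i <= complex.Re z <= right_node i /\
           (hmin D < (complex.Im z)%:E < hmax D)%E].

(* Above [c0] consecutive columns are reattached (which restores the slit
   rectangle, the tips of the slits included), cyclically (the sides of the
   rectangle are identified, giving the outer annulus). Below [c0] the right
   side of column [i] is identified with the left side of column [s i]: an
   identification of two left sides or of two right sides by a translation
   would not be compatible with [dz]. *)
Inductive glue (D : slit_rectangle) (s : {perm 'I_(slit_num D).+1}) :
    'I_(slit_num D).+1 * C -> 'I_(slit_num D).+1 * C -> Prop :=
| glue_above i (y : R) :
    c0 D <= y -> (y%:E < hmax D)%E ->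
    glue s (i, right_node i +i* y) (ordS i, left_node (ordS i) +i* y)
| glue_below i (y : R) :
    (hmin D < y%:E)%E -> y <= c0 D ->
    glue s (i, right_node i +i* y) (s i, left_node (s i) +i* y).

(* [T] is the topological quotient of the disjoint union of the columns by the
   gluing; [q i] is the projection, only meaningful on column [i]. *)
Definition is_gluing (D : slit_rectangle) (s : {perm 'I_(slit_num D).+1})
    (T : topologicalType) (q : 'I_(slit_num D).+1 -> C -> T) : Prop :=
  [/\ forall p, exists i z, column i z /\ q i z = p,
      forall i j z w, column i z -> column j w ->
        (q i z = q j w <-> clos_refl_sym_trans _ (glue s) (i, z) (j, w)) &
      forall A : set T, open A <->
        forall i, exists2 V : set C, open V &
          column i `&` q i @^-1` A = column i `&` V].

(* [zeta] is, on the open set [U], a primitive of [dz]: on each column it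
   differs from [z] by a locally constant function. *)
Definition translation_coordinate (D : slit_rectangle) (T : topologicalType)
    (q : 'I_(slit_num D).+1 -> C -> T) (U : set T) (zeta : T -> C) : Prop :=
  forall i z0, column i z0 -> U (q i z0) ->
    \forall z \near z0, column i z ->
      zeta (q i z) - z = zeta (q i z0) - z0.

(* The charts of the glued surface are the roots of primitives of [dz]: at a
   point with cone angle [2 pi k] one has [c = (z - z(p))^(1/k)]. *)
Definition root_chart (D : slit_rectangle) (T : topologicalType)
    (q : 'I_(slit_num D).+1 -> C -> T) (c : chart R T) : Prop :=
  is_chart c /\
  exists2 k : nat, (0 < k)%N &
    translation_coordinate q (chart_dom c) (fun p => c p ^+ k).

Record local_model_surface := LocalModelSurface {
  lms_surface :> riemann_surface R;
  lms_form : form lms_surface;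
  lms_rect : slit_rectangle;
  lms_pairing : {perm 'I_(slit_num lms_rect).+1};
  lms_proj : 'I_(slit_num lms_rect).+1 -> C -> lms_surface;
  lms_gluing : is_gluing lms_pairing lms_proj;
  lms_atlas : forall c : chart R lms_surface,
    rs_atlas c <-> root_chart lms_proj c;
  lms_planar : planar lms_surface;
  lms_form_holo : holomorphic_form lms_form;
  lms_form_dz : forall (U : set lms_surface) (zeta : lms_surface -> C),
    open U -> translation_coordinate lms_proj U zeta ->
    is_differential lms_form U zeta
}.

Arguments lms_proj : clear implicits.
Arguments lms_form : clear implicits.

Definition central_leaf (X : local_model_surface) : set X :=
  [set p | exists i z, [/\ column i z, complex.Im z = c0 (lms_rect X) &
                           p = lms_proj X i z]].

Arguments central_leaf : clear implicits.

Definition outer_height (X : local_model_surface) : \bar R :=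
  (hmax (lms_rect X) - (c0 (lms_rect X))%:E)%E.
Definition inner_height (X : local_model_surface) : \bar R :=
  ((c0 (lms_rect X))%:E - hmin (lms_rect X))%E.

Definition local_model_map (Y X : local_model_surface) (d : nat)
    (f : Y -> X) : Prop :=
  [/\ branched_cover d f,
      is_scaled_pullback (d%:R^-1) f (lms_form Y) (lms_form X) &
      f @` central_leaf Y = central_leaf X].

Definition isomorphism (Y X : local_model_surface) (f : Y -> X) : Prop :=
  local_model_map 1 f.

(* The circle R/2piZ is represented by the real line, relations on it by
   2pi-periodic relations; [circ_arc c e] is the open arc from [c] to [e]
   in the positive direction. *)
Definition circ_arc (c e x : R) : Prop :=
  exists k l : int, [/\ c < x + k%:~R * (2 * pi),
    x + k%:~R * (2 * pi) < e + l%:~R * (2 * pi) &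
    e + l%:~R * (2 * pi) < c + 2 * pi].

Definition circ_class (E : R -> R -> Prop) (t : R) : set R :=
  [set s | 0 <= s < 2 * pi /\ E t s].

Record finite_lamination := FiniteLamination {
  lam_rel :> R -> R -> Prop;
  lam_refl : forall t, lam_rel t t;
  lam_sym : forall s t, lam_rel s t -> lam_rel t s;
  lam_trans : forall r s t, lam_rel r s -> lam_rel s t -> lam_rel r t;
  lam_periodic : forall t, lam_rel t (t + 2 * pi);
  lam_finite : forall t, finite_set (circ_class lam_rel t);
  lam_cofinite : finite_set [set A : set R |
    (exists t, A = circ_class lam_rel t) /\ ~ exists s, A = [set s]];
  lam_unlinked : forall a b c e, lam_rel a b -> lam_rel c e -> ~ lam_rel a c ->
    (circ_arc c e a <-> circ_arc c e b)
}.

(* The orientation-preserving isometries of R/2piZ are the translations. *)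
Definition lamination_equiv (L L' : finite_lamination) : Prop :=
  exists theta : R, forall s t, L s t <-> L' (s + theta) (t + theta).

(* [p] is the image in the central leaf of the point [t] of the bottom
   boundary circle of the outer annulus, parametrized by [x]. *)
Definition leaf_point (X : local_model_surface) (t : R) (p : X) : Prop :=
  exists (i : 'I_(slit_num (lms_rect X)).+1) (k : int),
    let x := t + k%:~R * (2 * pi) in
    left_node i <= x <= right_node i /\
    p = lms_proj X i (x +i* c0 (lms_rect X)).

Definition associated_lamination (X : local_model_surface)
    (L : finite_lamination) : Prop :=
  forall s t, L s t <-> exists p : X, leaf_point s p /\ leaf_point t p.

End LocalModels.

(* Main.v *)
Require Import Defs.
From HB Require Import structures.
From Stdlib Require Import Relation_Operators.
From mathcomp Require Import all_boot all_order all_algebra perm complex.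
From mathcomp Require Import all_classical all_reals all_analysis.
From mathcomp Require Import ring lra zify.

(* Cut open along the slits, a local model surface is the image of the strip of
   all [(x, y)], [x] real, under a map [unroll] that is 2pi-periodic in [x] and
   is discontinuous only below [c0], across the lines through the nodes. There
   the left side of the line through [x] is glued to the right side of the line
   through [next x]. The heights and the map [next], up to translation, thus
   determine the surface: conjugating [next] to [next'] by a translation yields
   a homeomorphism that is a translation in the flat coordinates.

   (1) The classes of the lamination are the fibers of [unroll] at height [c0].
   Planarity forces [next x] to be the last point before [x] in the class of
   [x]: if a point [u] of the class lay strictly between [next x] and [x], the
   arc over [next x, x] that passes above [u] and closes up through the slit
   below [x] would be a Jordan curve whose two sides are joined through the
   common image of [u] and [x].

   (2) The equation [eta = f^* omega / d] says that [f] is [z |-> d z + const]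
   in flat coordinates. By unique continuation along horizontal lines above the
   central leaf, then along vertical lines that avoid the nodes, [f] is
   [unroll (x, y) |-> unroll (d x + b, d y)] for heights measured from the
   central leaves. Hence [next] on the target sends [d x + b] to
   [d next x + b], so it is determined by the source, up to translation. *)

Set Implicit Arguments.
Unset Strict Implicit.
Unset Printing Implicit Defensive.

Import Order.TTheory GRing.Theory Num.Theory numFieldNormedType.Exports.
Local Open Scope classical_set_scope.
Local Open Scope ring_scope.
Local Open Scope complex_scope.

Lemma subr_swap (V : zmodType) (a b c d : V) : a - b = c - d -> a - c = b - d.
Proof.
move/(canRL (subrK b)) ->.
by rewrite addrAC [X in X + _]addrAC subrr sub0r addrC.
Qed.

(** * Neighborhoods in the plane as open squares *)

Section ComplexPlane.
Variable R : realType.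
Local Notation C := ((R[i])^o).

Lemma normC_le (z : R[i]) : `|z| <= (`|complex.Re z| + `|complex.Im z|)%:C.
Proof.
rewrite normc_def lecR -[leRHS]ger0_norm ?addr_ge0 // -sqrtr_sqr.
apply: ler_wsqrtr; rewrite sqrrD !real_normK ?num_real //.
by rewrite [leRHS]addrAC lerDl mulrn_wge0 // mulr_ge0.
Qed.

Lemma normC_ge_Im (z : R[i]) : (`|complex.Im z|)%:C <= `|z|.
Proof.
rewrite normc_def lecR -sqrtr_sqr; apply: ler_wsqrtr.
by rewrite lerDr sqr_ge0.
Qed.

Lemma gt0_realC (e : R[i]) : 0 < e -> exists2 r : R, 0 < r & e = r%:C.
Proof.
case: e => a b; rewrite ltcE /= => /andP[/eqP -> a0].
by exists a.
Qed.

Lemma nbhsCP (z : C) (A : set C) : nbhs z A <-> exists2 e : R, 0 < e &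
  forall w : C, `|complex.Re w - complex.Re z| < e ->
    `|complex.Im w - complex.Im z| < e -> A w.
Proof.
split.
  move=> /nbhs_ballP[e /= /gt0_realC[r r0 ->] zA]; exists (r / 2) => [|w wr wi].
    by rewrite divr_gt0.
  apply: zA; rewrite -ball_normE /= distrC.
  apply: le_lt_trans (normC_le _) _; rewrite ltcR.
  have -> : complex.Re (w - z : R[i]) = complex.Re w - complex.Re z.
    by case: (w) (z) => ? ? [].
  have -> : complex.Im (w - z : R[i]) = complex.Im w - complex.Im z.
    by case: (w) (z) => ? ? [].
  by rewrite (splitr r) ltrD.
move=> [e e0 zA]; apply/nbhs_ballP; exists e%:C => /=; first by rewrite ltcR.
move=> w; rewrite -ball_normE /= distrC => wz; apply: zA; rewrite -ltcR.
  apply: le_lt_trans wz; rewrite (_ : _ - _ = complex.Re (w - z : R[i])).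
    exact: normc_ge_Re.
  by case: (w) (z) => ? ? [].
apply: le_lt_trans wz; rewrite (_ : _ - _ = complex.Im (w - z : R[i])).
  exact: normC_ge_Im.
by case: (w) (z) => ? ? [].
Qed.

Lemma nbhsRP (x : R) (A : set R) : nbhs x A <->
  exists2 e : R, 0 < e & forall y, `|y - x| < e -> A y.
Proof.
split=> [/nbhs_ballP[e e0 xA]|[e e0 xA]].
  by exists e => // y yx; apply: xA; rewrite -ball_normE /= distrC.
apply/nbhs_ballP; exists e => // y; rewrite -ball_normE /= distrC; exact: xA.
Qed.

End ComplexPlane.

(** * The circle and the columns *)

Section Columns.
Variable R : realType.
Local Notation C := ((R[i])^o).
Local Notation tau := (2 * pi : R).

Definition eqmod (x y : R) : Prop := exists k : int, y = x + k%:~R * tau.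

Lemma tau_gt0 : 0 < tau.
Proof. by rewrite mulr_gt0 ?pi_gt0. Qed.

Lemma eqmod_refl x : eqmod x x.
Proof. by exists 0; rewrite mul0r addr0. Qed.

Lemma eqmod_sym x y : eqmod x y -> eqmod y x.
Proof. by case=> k ->; exists (- k); rewrite rmorphN /=; ring. Qed.

Lemma eqmod_trans x y z : eqmod x y -> eqmod y z -> eqmod x z.
Proof. by case=> k -> [l ->]; exists (k + l); rewrite rmorphD /=; ring. Qed.

Lemma eqmodD x y t : eqmod x y -> eqmod (x + t) (y + t).
Proof. by case=> k ->; exists k; ring. Qed.

Lemma eqmodMn x y (d : nat) : eqmod x y -> eqmod (d%:R * x) (d%:R * y).
Proof. by case=> k ->; exists (d%:Z * k); rewrite rmorphM /=; ring. Qed.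

Lemma eqmod_eq x y : eqmod x y -> `|y - x| < tau -> x = y.
Proof.
case=> k ->; rewrite addrC addKr normrM (gtr0_norm tau_gt0).
rewrite -[ltRHS]mul1r ltr_pM2r ?tau_gt0 // -intr_norm (ltr_int _ _ 1).
move=> k1; have -> : k = 0 by lia.
by rewrite mul0r addr0.
Qed.

Lemma reduce_mod (a x : R) : exists2 y, eqmod x y & a <= y < a + tau.
Proof.
have t0 := tau_gt0.
exists (x + (- Num.floor ((x - a) / tau))%:~R * tau); first by eexists.
have /andP[f1 f2] : (Num.floor ((x - a) / tau))%:~R <= (x - a) / tau <
   (Num.floor ((x - a) / tau))%:~R + 1.
  by have := floor_itv ((x - a) / tau); rewrite rmorphD.
move: f1 f2; rewrite ler_pdivlMr // ltr_pdivrMr // => f1 f2.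
rewrite rmorphN /=; lra.
Qed.

Variable D : slit_rectangle R.
Local Notation n := (slit_num D).
Implicit Types i j : 'I_n.+1.

Lemma node_mono (i j : 'I_n.+2) : (i <= j)%N -> node i <= node j.
Proof.
rewrite leq_eqVlt => /orP[/eqP ij|/(@node_incr _ D)/ltW //].
by rewrite (val_inj ij).
Qed.

Lemma left_lt_right i : left_node i < right_node i.
Proof. by apply: node_incr; rewrite /= /bump add1n. Qed.

Lemma right_le_left i j : (i < j)%N -> right_node i <= left_node j.
Proof. by move=> ij; apply: node_mono; rewrite /= /bump add1n. Qed.

Lemma left_ge0 i : 0 <= left_node i.
Proof. by rewrite -(node_first D); apply: node_mono. Qed.

Lemma right_le_tau i : right_node i <= tau.
Proof.
by rewrite -(node_last D); apply: node_mono; rewrite /= /bump add1n ltn_ord.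
Qed.

Lemma column_ex0 x : 0 <= x < tau -> exists i, left_node i <= x < right_node i.
Proof.
move=> /andP[x0 xt].
have P0 : node (ord0 : 'I_n.+2) <= x by rewrite node_first.
case: (@arg_maxnP 'I_n.+2 ord0 (fun j : 'I_n.+2 => node j <= x) val P0) => m mx
  maxm.
have mn : (m < n.+1)%N.
  rewrite ltn_neqAle -ltnS ltn_ord andbT; apply/eqP => mE.
  have : node m = node (ord_max : 'I_n.+2) by congr node; apply: val_inj.
  by rewrite node_last => mt; move: mx xt; rewrite mt => ? ?; lra.
exists (Ordinal mn); apply/andP; split.
  by rewrite /left_node (_ : widen_ord _ _ = m) //; exact: val_inj.
rewrite ltNge; apply/negP => /maxm /=; rewrite /bump /= add1n.
by rewrite ltnn.
Qed.

Lemma column_ex x : exists ik : 'I_n.+1 * int,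
  left_node ik.1 <= x + ik.2%:~R * tau < right_node ik.1.
Proof.
have [y [k ->]] := reduce_mod 0 x; rewrite add0r => /column_ex0[i xi].
by exists (i, k).
Qed.

(** Both points lie in the fundamental interval from [0] to [tau], so they are equal once congruent,
    and the half-open columns are disjoint. *)
Lemma column_uniq x y i j : eqmod x y -> left_node i <= x < right_node i ->
  left_node j <= y < right_node j -> i = j /\ x = y.
Proof.
move=> xy xi yj; have E : x = y.
  apply: eqmod_eq => //.
  have := left_ge0 i; have := left_ge0 j; have := right_le_tau i.
  by have := right_le_tau j; rewrite ltr_norml; lra.
split=> //; apply: val_inj => /=; case: (ltngtP i j) => // ij.
  by exfalso; have {ij} := right_le_left ij; lra.
by exfalso; have {ij} := right_le_left ij; lra.
Qed.

Lemma left_ordS i : eqmod (right_node i) (left_node (ordS i)) /\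
  forall j, left_node j = left_node (ordS i) -> j = ordS i.
Proof.
split; last first.
  move=> j E; apply: val_inj => /=; case: (ltngtP j (ordS i)) => // ij.
    by exfalso; have {ij} := right_le_left ij; have := left_lt_right j; lra.
  by exfalso; have {ij} := right_le_left ij; have := left_lt_right (ordS i);
    lra.
(* The last column ends at [tau], and [ordS] wraps it around to the column starting at [0]; this is
   the only case with a nonzero period. *)
have := ltn_ord i; rewrite ltnS leq_eqVlt => /orP[/eqP ei|li].
  have -> : right_node i = tau.
    rewrite -(node_last D); congr node; apply: val_inj => /=.
    by rewrite /bump add1n ei.
  have -> : left_node (ordS i) = 0.
    rewrite -(node_first D); congr node; apply: val_inj => /=.
    by rewrite ei modnn.
  by exists (- 1); rewrite mulN1r subrr.
rewrite (_ : left_node _ = right_node i); first exact: eqmod_refl.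
congr node; apply: val_inj => /=; by rewrite modn_small.
Qed.

Lemma column_exl x : exists ik : 'I_n.+1 * int,
  left_node ik.1 < x + ik.2%:~R * tau <= right_node ik.1.
Proof.
have [[i k] /= /andP[]] := column_ex x.
rewrite le_eqVlt => /orP[/eqP E _|xi xr]; last by exists (i, k); rewrite xi ltW.
(* Up to a period, the left end of column [i] is also the right end of the cyclically preceding
   column. *)
have [[l E'] _] := left_ordS (ord_pred i).
rewrite ord_predK in E'.
exists (ord_pred i, k - l) => /=.
have -> : x + (k - l)%:~R * tau = right_node (ord_pred i).
  by rewrite rmorphB /= mulrBl addrA -E E'; ring.
by rewrite left_lt_right lexx.
Qed.

Lemma column_uniql x y i j : eqmod x y -> left_node i < x <= right_node i ->
  left_node j < y <= right_node j -> i = j /\ x = y.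
Proof.
move=> xy xi yj; have E : x = y.
  apply: eqmod_eq => //.
  have := left_ge0 i; have := left_ge0 j; have := right_le_tau i.
  by have := right_le_tau j; rewrite ltr_norml; lra.
split=> //; apply: val_inj => /=; case: (ltngtP i j) => // ij.
  by exfalso; have {ij} := right_le_left ij; lra.
by exfalso; have {ij} := right_le_left ij; lra.
Qed.

(** The sides of the rectangle count as nodes too, as [left_node ord0] is [0]. *)
Definition is_node (x : R) : Prop := exists i, eqmod x (left_node i).

Lemma is_node_eqmod x y : eqmod x y -> is_node x -> is_node y.
Proof.
by move=> xy [i xi]; exists i; apply: eqmod_trans xi; apply: eqmod_sym.
Qed.

Lemma is_node_right i : is_node (right_node i).
Proof. by exists (ordS i); case: (left_ordS i). Qed.

Lemma not_node_column x i : left_node i < x < right_node i -> ~ is_node x.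
Proof.
move=> xi [j xj].
have jj : left_node j <= left_node j < right_node j.
  by rewrite lexx left_lt_right.
have xi' : left_node i <= x < right_node i by lra.
have [ij E] := column_uniq xj xi' jj.
by move: xi; rewrite E ij; lra.
Qed.

(** The columns on the two sides of [x] cover a punctured neighborhood of it, and their interiors
    contain no node. *)
Lemma not_node_near x : exists2 e : R, 0 < e &
  forall y, `|y - x| < e -> y <> x -> ~ is_node y.
Proof.
have [[i k] /= xi] := column_ex x.
have [[j l] /= xj] := column_exl x.
exists (Num.min (right_node i - (x + k%:~R * tau))
                (x + l%:~R * tau - left_node j)).
  by rewrite lt_min; lra.
move=> y; rewrite lt_min !ltr_norml => /andP[y1 y2] yx.
have [xy|xy] : x < y \/ y < x by apply/orP; rewrite -neq_lt eq_sym; apply/eqP.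
  move=> /(is_node_eqmod (y := y + k%:~R * tau)) H.
  by apply: (@not_node_column _ i _ (H _)); [lra|exists k].
move=> /(is_node_eqmod (y := y + l%:~R * tau)) H.
by apply: (@not_node_column _ j _ (H _)); [lra|exists l].
Qed.

End Columns.

(** * Unrolling a local model surface *)

Section Unrolling.
Variables (R : realType) (X : local_model_surface R).
Local Notation C := ((R[i])^o).
Local Notation tau := (2 * pi : R).
Local Notation D := (lms_rect X).
Local Notation n := (slit_num D).
Local Notation q := (@lms_proj R X).
Local Notation s := (@lms_pairing R X).
Implicit Types (i j : 'I_n.+1) (x y : R).

Definition valid y : Prop := (hmin D < y%:E < hmax D)%E.

Lemma valid_c0 : valid (c0 D).
Proof. by rewrite /valid hmin_c0 c0_hmax. Qed.

Lemma valid_between y1 y2 y : valid y1 -> valid y2 -> y1 <= y <= y2 -> valid y.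
Proof.
move=> /andP[a1 b1] /andP[a2 b2] /andP[y1y yy2]; apply/andP; split.
  by apply: lt_le_trans a1 _; rewrite lee_fin.
by apply: le_lt_trans b2; rewrite lee_fin.
Qed.

Lemma valid_near y : valid y -> exists2 e : R, 0 < e &
  forall y', `|y' - y| < e -> valid y'.
Proof.
case/andP=> y1 y2.
have [e1 e10 H1] : exists2 e : R, 0 < e &
    forall y', `|y' - y| < e -> (hmin D < y'%:E)%E.
  case: (hmin D) y1 => [r| |] //; last by exists 1 => // *; exact: ltNyr.
  rewrite lte_fin => ry; exists (y - r) => [|y']; first lra.
  by rewrite lte_fin ltr_norml; lra.
have [e2 e20 H2] : exists2 e : R, 0 < e &
    forall y', `|y' - y| < e -> (y'%:E < hmax D)%E.
  case: (hmax D) y2 => [r| |] //; last by exists 1 => // *; exact: ltry.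
  rewrite lte_fin => ry; exists (r - y) => [|y']; first lra.
  by rewrite lte_fin ltr_norml; lra.
exists (Num.min e1 e2) => [|y']; first by rewrite lt_min e10.
by rewrite lt_min => /andP[? ?]; apply/andP; split; [apply: H1|apply: H2].
Qed.

Lemma columnE i x y : column i (x +i* y : C) <->
  left_node i <= x <= right_node i /\ valid y.
Proof. by []. Qed.

(* The half-open columns tile the strip: [unroll] is the projection from the
   strip, right-continuous in [x]; [unroll_left] is its left-continuous
   variant. They differ only below [c0], on the lines through the nodes. *)
Definition unroll x y : X :=
  let ik := projT1 (cid (column_ex D x)) in
  q ik.1 ((x + ik.2%:~R * tau) +i* y).

Definition unroll_left x y : X :=
  let ik := projT1 (cid (column_exl D x)) in
  q ik.1 ((x + ik.2%:~R * tau) +i* y).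

Lemma unrollE x x' i y : eqmod x x' -> left_node i <= x' < right_node i ->
  unroll x y = q i (x' +i* y).
Proof.
move=> xx' xi; rewrite /unroll; case: (cid _) => -[j k] /= xj.
by have [|-> ->] := column_uniq _ xj xi => //; apply: eqmod_trans xx';
  exists (- k); rewrite rmorphN /=; ring.
Qed.

Lemma unroll_leftE x x' i y : eqmod x x' ->
  left_node i < x' <= right_node i -> unroll_left x y = q i (x' +i* y).
Proof.
move=> xx' xi; rewrite /unroll_left; case: (cid _) => -[j k] /= xj.
by have [|-> ->] := column_uniql _ xj xi => //; apply: eqmod_trans xx';
  exists (- k); rewrite rmorphN /=; ring.
Qed.

Lemma unroll_eqmod x x' y : eqmod x x' -> unroll x y = unroll x' y.
Proof.
move=> xx'; have [[i k] /= xi] := column_ex D x'.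
rewrite (unrollE (x' := x' + k%:~R * tau) (i := i)) ?(unrollE _ _ xi) //.
  by exists k.
by apply: eqmod_trans xx' _; exists k.
Qed.

Lemma unroll_left_eqmod x x' y : eqmod x x' ->
  unroll_left x y = unroll_left x' y.
Proof.
move=> xx'; have [[i k] /= xi] := column_exl D x'.
rewrite (unroll_leftE (x' := x' + k%:~R * tau) (i := i)) ?(unroll_leftE _ _ xi)
  //.
  by exists k.
by apply: eqmod_trans xx' _; exists k.
Qed.

Lemma proj_glue i j (z w : C) : column i z -> column j w ->
  Defs.glue s (i, z) (j, w) -> q i z = q j w.
Proof.
move=> iz jw g; have [_ H _] := lms_gluing X; apply/H => //.
exact: rst_step.
Qed.

Lemma column_left i y : valid y -> column i (left_node i +i* y : C).
Proof. by move=> vy; apply/columnE; rewrite lexx ltW ?left_lt_right. Qed.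

Lemma column_right i y : valid y -> column i (right_node i +i* y : C).
Proof. by move=> vy; apply/columnE; rewrite lexx ltW ?left_lt_right. Qed.

Lemma unroll_left_node i y : unroll (left_node i) y = q i (left_node i +i* y).
Proof.
by apply: unrollE; [exact: eqmod_refl|rewrite lexx left_lt_right].
Qed.

Lemma unroll_right_node i y :
  unroll_left (right_node i) y = q i (right_node i +i* y).
Proof.
by apply: unroll_leftE; [exact: eqmod_refl|rewrite lexx left_lt_right].
Qed.

Lemma unroll_left_regular x y : ~ is_node D x -> unroll_left x y = unroll x y.
Proof.
move=> nx; have [[i k] /= xi] := column_exl D x.
have E : eqmod x (x + k%:~R * tau) by exists k.
rewrite (unroll_leftE _ E xi) (unrollE (i := i) _ E) //.
case/andP: xi => /ltW -> /=; rewrite le_eqVlt => /orP[/eqP H|//].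
by case: nx; apply: is_node_eqmod (is_node_right i); rewrite -H; apply:
  eqmod_sym.
Qed.

Lemma node_cases x : (exists i, eqmod x (right_node i)) \/ ~ is_node D x.
Proof.
have [[i k] /= /andP[xi]] := column_exl D x.
rewrite le_eqVlt => /orP[/eqP H|xr]; first by left; exists i, k.
right=> /(is_node_eqmod (y := x + k%:~R * tau)) H.
by apply: (@not_node_column _ _ _ i _ (H _)); [rewrite xi|exists k].
Qed.

(** Over a node this is the reattachment of consecutive columns. The height [c0] itself is included,
    where both kinds of gluing hold. *)
Lemma unroll_left_above x y : valid y -> c0 D <= y ->
  unroll_left x y = unroll x y.
Proof.
move=> vy y0; case: (node_cases x) => [[i xi]|]; last exact:
  unroll_left_regular.
rewrite (unroll_left_eqmod _ xi) (unroll_eqmod _ xi) unroll_right_node.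
rewrite (unroll_eqmod _ (proj1 (left_ordS i))) unroll_left_node.
apply: proj_glue; [exact: column_right|exact: column_left|].
by apply: glue_above => //; case/andP: vy.
Qed.

(** A half-open window of length [tau] holds one representative of each point of the circle. Away
    from the nodes nothing is cut, and the representative of [x] in the window before it is
    [x - tau]. *)
Lemma next_ex x : exists a, [/\ x - tau <= a < x,
  forall i, eqmod x (right_node i) -> eqmod a (left_node (s i)) &
  ~ is_node D x -> a = x - tau].
Proof.
case: (node_cases x) => [[i xi]|nx]; last first.
  exists (x - tau); split=> // [|i xi]; first by have := @tau_gt0 R; lra.
  by case: nx; apply: is_node_eqmod (is_node_right i); apply: eqmod_sym.
have [a sa ax] := reduce_mod (x - tau) (left_node (s i)).
exists a; split=> [|j xj|[]]; [by lra| |].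
  have [|||-> _] := @column_uniql _ _ (right_node j) (right_node i) j i.
  - by apply: eqmod_trans xi; apply: eqmod_sym.
  - by rewrite lexx left_lt_right.
  - by rewrite lexx left_lt_right.
  by apply: eqmod_sym.
by apply: is_node_eqmod (is_node_right i); apply: eqmod_sym.
Qed.

(* Lift to the line of the first return map of the bottom of the outer annulus
   defined by crossing the slits: below [c0], the left side of [x] is glued to
   the right side of [next x]. *)
Definition next x : R := projT1 (cid (next_ex x)).

Lemma next_itv x : x - tau <= next x < x.
Proof. by rewrite /next; case: cid => a []. Qed.

Lemma next_right x i : eqmod x (right_node i) ->
  eqmod (next x) (left_node (s i)).
Proof. by rewrite /next; case: cid => a /= [_ H _] /H. Qed.

Lemma next_regular x : ~ is_node D x -> next x = x - tau.
Proof. by rewrite /next; case: cid => a /= [_ _ H] /H. Qed.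

Lemma is_node_next x : is_node D (next x) <-> is_node D x.
Proof.
case: (node_cases x) => [[i xi]|nx]; last first.
  rewrite next_regular //; split=> //; apply: is_node_eqmod.
  by exists 1; rewrite mul1r subrK.
split=> _; first by apply: is_node_eqmod (is_node_right i); apply: eqmod_sym.
by exists (s i); exact: next_right.
Qed.

Lemma unroll_left_below x y : valid y -> y <= c0 D ->
  unroll_left x y = unroll (next x) y.
Proof.
move=> vy y0; case: (node_cases x) => [[i xi]|nx]; last first.
  rewrite unroll_left_regular // next_regular //; apply: unroll_eqmod.
  by exists (- 1); rewrite mulN1r.
rewrite (unroll_left_eqmod _ xi) unroll_right_node.
rewrite (unroll_eqmod _ (next_right xi)) unroll_left_node.
apply: proj_glue; [exact: column_right|exact: column_left|].
by apply: glue_below => //; case/andP: vy.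
Qed.

Lemma unroll_left_unroll x y : valid y ->
  exists x', unroll_left x y = unroll x' y.
Proof.
move=> vy; case: (leP y (c0 D)) => y0.
  by exists (next x); exact: unroll_left_below.
by exists x; apply: unroll_left_above => //; exact: ltW.
Qed.

Lemma unroll_surj (p : X) : exists x y, valid y /\ p = unroll x y.
Proof.
have [H _ _] := lms_gluing X; have [i [[x y] [[xi vy] <-]]] := H p.
case/andP: xi => /= xl; rewrite le_eqVlt => /orP[/eqP ->|xr].
  have [x' E] := unroll_left_unroll (right_node i) vy.
  by exists x', y; split=> //; rewrite -E unroll_right_node.
by exists x, y; split=> //; rewrite (unrollE (x' := x) (i := i)) ?xl //; exact:
  eqmod_refl.
Qed.

(** The universal property of the quotient, read in the strip: [G] and [Gl] prescribe the values on
    the right and on the left of each vertical line, and the last two hypotheses express the two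
    kinds of gluing. *)
Lemma descent (T : Type) (G Gl : R -> R -> T) :
  (forall x x' y, eqmod x x' -> G x y = G x' y) ->
  (forall x x' y, eqmod x x' -> Gl x y = Gl x' y) ->
  (forall x y, valid y -> c0 D <= y -> Gl x y = G x y) ->
  (forall x y, valid y -> y <= c0 D -> Gl x y = G (next x) y) ->
  exists f : X -> T, forall x y, valid y ->
    f (unroll x y) = G x y /\ f (unroll_left x y) = Gl x y.
Proof.
move=> Gp Glp Ga Gb.
(* The right side of a column belongs to [unroll_left]; every other point is read off by [G]. *)
pose H (iz : 'I_n.+1 * C) := if complex.Re iz.2 < right_node iz.1
  then G (complex.Re iz.2) (complex.Im iz.2)
  else Gl (complex.Re iz.2) (complex.Im iz.2).
have Hl i y : H (i, (left_node i +i* y : C)) = G (left_node i) y.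
  by rewrite /H /= left_lt_right.
have Hr i y : H (i, (right_node i +i* y : C)) = Gl (right_node i) y.
  by rewrite /H /= ltxx.
have Hg a b : clos_refl_sym_trans _ (Defs.glue s) a b -> H a = H b.
  elim=> [{}a {}b []|//|//|? ? ? _ -> _ ->] // i y y1 y2; rewrite Hl Hr.
    rewrite -(Gp _ _ _ (proj1 (left_ordS i))) Ga // /valid y2 andbT.
    by apply: lt_le_trans (hmin_c0 D) _; rewrite lee_fin.
  rewrite Gb ?(Gp _ _ _ (next_right (eqmod_refl _))) // /valid y1 /=.
  by apply: le_lt_trans (c0_hmax D); rewrite lee_fin.
have [Hs Hq _] := lms_gluing X.
have F (p : X) : exists t, forall i z, column i z -> q i z = p -> H (i, z) = t.
  have [i [z [iz <-]]] := Hs p; exists (H (i, z)) => j w jw wz.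
  by apply: Hg; apply/Hq.
exists (fun p => projT1 (cid (F p))) => x y vy; split.
  case: cid => t /= Ht; have [[i k] /= xi] := column_ex D x.
  have E : eqmod x (x + k%:~R * tau) by exists k.
  rewrite (Gp _ _ _ E) -(Ht i ((x + k%:~R * tau) +i* y)).
  - by rewrite /H /=; case/andP: xi => _ ->.
  - by apply/columnE; split=> //; lra.
  - by rewrite (unrollE _ E xi).
case: cid => t /= Ht; have [[i k] /= xi] := column_exl D x.
have E : eqmod x (x + k%:~R * tau) by exists k.
rewrite -(Ht i ((x + k%:~R * tau) +i* y)); first last.
- by rewrite (unroll_leftE _ E xi).
- by apply/columnE; split=> //; lra.
case/andP: (xi) => xl; rewrite le_eqVlt => /orP[/eqP xr|xr].
  by rewrite xr Hr (Glp _ _ _ E) xr.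
(* Inside a column the hypotheses already give [Gl = G]: above [c0] directly, and below it because
   [next x] is [x - tau]. *)
rewrite /H /= xr -(Gp _ _ _ E).
case: (leP (c0 D) y) => y0; first by rewrite Ga.
rewrite Gb ?ltW // next_regular; last first.
  move=> nx; apply: (@not_node_column _ D (x + k%:~R * tau) i).
    by rewrite xl.
  exact: is_node_eqmod E nx.
by apply: Gp; exists (- 1); rewrite mulN1r.
Qed.

(** The columns are closed, so a neighborhood in the quotient is tested by boxes on one side of a
    vertical line, with the unrolling that is continuous from that side. *)
Definition near_right x y (P : R -> R -> Prop) : Prop :=
  exists2 e : R, 0 < e & forall x' y', x <= x' < x + e -> `|y' - y| < e ->
    valid y' -> P x' y'.

Definition near_left x y (P : R -> R -> Prop) : Prop :=
  exists2 e : R, 0 < e & forall x' y', x - e < x' <= x -> `|y' - y| < e ->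
    valid y' -> P x' y'.

(** [rel] is left abstract so that one passage from columns to the strip serves both the open sets
    and the flat coordinates. For the converse, a box around a point of a column is split into its
    left and right halves. *)
Lemma column_near (U : set X) (rel : X -> X -> C -> Prop) :
  (forall i z, column i z -> U (q i z) -> \forall w \near z, column i w ->
     rel (q i z) (q i w) (w - z)) <->
  (forall x y, valid y -> U (unroll x y) ->
     near_right x y (fun x' y' =>
       rel (unroll x y) (unroll x' y') ((x' - x) +i* (y' - y)))) /\
  (forall x y, valid y -> U (unroll_left x y) ->
     near_left x y (fun x' y' =>
       rel (unroll_left x y) (unroll_left x' y') ((x' - x) +i* (y' - y)))).
Proof.
split=> [H|[Hr Hl] i [a b] [/= ai vb] Uz].
  split=> x y vy.
    have [[i k] /= xi] := column_ex D x.
    have E : eqmod x (x + k%:~R * tau) by exists k.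
    rewrite (unrollE _ E xi) => Ux.
    have xy : column i ((x + k%:~R * tau) +i* y : C).
      by apply/columnE; split=> //; lra.
    have /nbhsCP[e e0 He] := H _ _ xy Ux.
    exists (Num.min e (right_node i - (x + k%:~R * tau))).
      by rewrite lt_min e0; lra.
    move=> x' y' /andP[xx']; rewrite -ltrBlDl !lt_min.
    move=> /andP[x'e x'r] /andP[ye yr] vy'.
    have E' : eqmod x' (x' + k%:~R * tau) by exists k.
    have xi' : left_node i <= x' + k%:~R * tau < right_node i by lra.
    rewrite (unrollE _ E' xi').
    have -> : (x' - x) +i* (y' - y) =
       ((x' + k%:~R * tau) +i* y' : C) - ((x + k%:~R * tau) +i* y).
      by simpc; congr (_ +i* _); ring.
    apply: He => //=; last by apply/columnE; split=> //; lra.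
    by rewrite ltr_norml; lra.
  have [[i k] /= xi] := column_exl D x.
  have E : eqmod x (x + k%:~R * tau) by exists k.
  rewrite (unroll_leftE _ E xi) => Ux.
  have xy : column i ((x + k%:~R * tau) +i* y : C).
    by apply/columnE; split=> //; lra.
  have /nbhsCP[e e0 He] := H _ _ xy Ux.
  exists (Num.min e (x + k%:~R * tau - left_node i)).
    by rewrite lt_min e0; lra.
  move=> x' y' /andP[]; rewrite ltrBlDl -ltrBlDr !lt_min.
  move=> /andP[x'e x'r] xx' /andP[ye yr] vy'.
  have E' : eqmod x' (x' + k%:~R * tau) by exists k.
  have xi' : left_node i < x' + k%:~R * tau <= right_node i by lra.
  rewrite (unroll_leftE _ E' xi').
  have -> : (x' - x) +i* (y' - y) =
     ((x' + k%:~R * tau) +i* y' : C) - ((x + k%:~R * tau) +i* y).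
    by simpc; congr (_ +i* _); ring.
  apply: He => //=; last by apply/columnE; split=> //; lra.
  by rewrite ltr_norml; lra.
(* The right half of the box is needed only when [a] is not the right end of its column; otherwise
   the radius [1] is a placeholder. *)
have [er er0 HR] : exists2 e : R, 0 < e & a < right_node i ->
    e <= right_node i - a /\ forall x' y', a <= x' < a + e -> `|y' - b| < e ->
    valid y' -> rel (q i (a +i* b)) (unroll x' y') ((x' - a) +i* (y' - b)).
  case: (ltP a (right_node i)) => ar; last by exists 1.
  have ai' : left_node i <= a < right_node i by lra.
  have := Hr a b vb; rewrite (unrollE _ (eqmod_refl _) ai') => -[//|e e0 He].
  exists (Num.min e (right_node i - a)) => [|_]; first by rewrite lt_min e0;
    lra.
  split=> [|x' y']; first by rewrite ge_min lexx orbT.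
  rewrite -ltrBlDl !lt_min => /andP[ax /andP[x'e _]] /andP[ye _].
  by apply: He => //; lra.
have [el el0 HL] : exists2 e : R, 0 < e & left_node i < a ->
    e <= a - left_node i /\ forall x' y', a - e < x' <= a -> `|y' - b| < e ->
    valid y' -> rel (q i (a +i* b)) (unroll_left x' y') ((x' - a) +i* (y' - b)).
  case: (ltP (left_node i) a) => al; last by exists 1.
  have ai' : left_node i < a <= right_node i by lra.
  have := Hl a b vb; rewrite (unroll_leftE _ (eqmod_refl _) ai') => -[//|e e0
    He].
  exists (Num.min e (a - left_node i)) => [|_]; first by rewrite lt_min e0; lra.
  split=> [|x' y']; first by rewrite ge_min lexx orbT.
  rewrite ltrBlDl -ltrBlDr !lt_min => /andP[/andP[x'e _] ax] /andP[ye _].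
  by apply: He => //; lra.
apply/nbhsCP; exists (Num.min er el); first by rewrite lt_min er0.
move=> [x' y'] /=; rewrite !lt_min !ltr_norml => /andP[x1 x2] /andP[y1 y2].
move=> /columnE[xi' vy'].
have -> : (x' +i* y' : C) - (a +i* b) = (x' - a) +i* (y' - b) by simpc.
case: (leP a x') => ax'; last first.
  have [|e1 {}HL] := HL; first by lra.
  rewrite -(@unroll_leftE x' x' i y'); [|exact: eqmod_refl|lra].
  by apply: HL => //; [lra|rewrite ltr_norml].
case: (ltP a (right_node i)) => ar.
  have [|e1 {}HR] := HR; first by lra.
  rewrite -(@unrollE x' x' i y'); [|exact: eqmod_refl|lra].
  by apply: HR => //; [lra|rewrite ltr_norml].
(* Here [a] is the right end, so [x' = a], and the left half of the box contains this point. *)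
have := left_lt_right i => lr.
have [|e1 {}HL] := HL; first by lra.
rewrite -(@unroll_leftE x' x' i y'); [|exact: eqmod_refl|lra].
by apply: HL => //; [lra|rewrite ltr_norml].
Qed.

Lemma open_unroll (A : set X) : open A <->
  (forall x y, valid y -> A (unroll x y) ->
     near_right x y (fun x' y' => A (unroll x' y'))) /\
  (forall x y, valid y -> A (unroll_left x y) ->
     near_left x y (fun x' y' => A (unroll_left x' y'))).
Proof.
rewrite -(column_near A (fun _ p _ => A p)).
have [_ _ ->] := lms_gluing X; split=> H i.
  move=> z iz Az; have [V Vo VE] := H i.
  have [_ Vz] : (column i `&` V) z by rewrite -VE.
  have : nbhs z V by apply: open_nbhs_nbhs.
  apply: filterS => w Vw iw.
  by have : (column i `&` V) w by []; rewrite -VE => -[].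
exists (interior [set w : C | column i w -> A (q i w)]).
  exact: open_interior.
apply/seteqP; split=> w [iw Aw]; split=> //; first exact: H.
by have := interior_subset Aw; apply.
Qed.

Lemma translation_unroll (U : set X) (zeta : X -> C) :
  translation_coordinate q U zeta <->
  (forall x y, valid y -> U (unroll x y) ->
     near_right x y (fun x' y' =>
       zeta (unroll x' y') - zeta (unroll x y) = (x' - x) +i* (y' - y))) /\
  (forall x y, valid y -> U (unroll_left x y) ->
     near_left x y (fun x' y' =>
       zeta (unroll_left x' y') - zeta (unroll_left x y)
         = (x' - x) +i* (y' - y))).
Proof.
rewrite -(column_near U (fun p p' d => zeta p' - zeta p = d)).
split=> H i z iz Uz; apply: filterS (H i z iz Uz) => w Hw /Hw; exact: subr_swap.
Qed.

End Unrolling.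

(* [lra] fails on equations between points of a surface, and is slow when it
   has to discard many hypotheses. *)
Ltac lra_real := repeat match goal with
  | H : @eq (Topological.sort _) _ _ |- _ => clear H
  | H : forall _, _ |- _ => clear H
  | H : valid _ _ |- _ => clear H
  | H : eqmod _ _ |- _ => clear H
  | |- @eq (Topological.sort _) _ _ => intros; exfalso end; lra.

(** * Fibers of the unrolling, and paths in the surface *)

Section Injectivity.
Variables (R : realType) (X : local_model_surface R).
Local Notation C := ((R[i])^o).
Local Notation tau := (2 * pi : R).
Local Notation D := (lms_rect X).
Local Notation c0 := (c0 D).
Local Notation valid := (valid X).
Local Notation unroll := (unroll X).
Local Notation unroll_left := (unroll_left X).
Local Notation next := (next X).

Lemma height_ex : exists h : X -> R, forall x y, valid y ->
  h (unroll x y) = y /\ h (unroll_left x y) = y.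
Proof. exact: (@descent R X R (fun _ y => y) (fun _ y => y)). Qed.

Definition height : X -> R := projT1 (cid height_ex).

Lemma height_unroll x y : valid y -> height (unroll x y) = y.
Proof. by rewrite /height; case: cid => h /= H vy; case: (H x y vy). Qed.

Lemma height_unroll_left x y : valid y -> height (unroll_left x y) = y.
Proof. by rewrite /height; case: cid => h /= H vy; case: (H x y vy). Qed.

Lemma lift_uniq (x a b : R) : x - tau <= a < x -> x - tau <= b < x ->
  eqmod a b -> a = b.
Proof. by move=> xa xb ab; apply: (eqmod_eq ab); rewrite ltr_norml; lra_real.
  Qed.

Lemma next_eqmod x x' : eqmod x x' -> eqmod (next x) (next x').
Proof.
move=> xx'; case: (node_cases X x) => [[i xi]|nx].
  apply: eqmod_trans (next_right xi) _; apply: eqmod_sym; apply: next_right.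
  by apply: eqmod_trans xi; apply: eqmod_sym.
rewrite !next_regular //; first exact: eqmodD.
by move=> nx'; apply: nx; apply: is_node_eqmod nx'; apply: eqmod_sym.
Qed.

(** Points are separated by [Prop]-valued functions on the surface, built with [descent], that test
    whether an abscissa is congruent to [x]. At height [c0] the nodes must be excluded, since there
    the gluings above and below both act. *)
Lemma unroll_inj x y x' y' : valid y -> valid y' ->
  y <> c0 \/ ~ is_node D x ->
  unroll x y = unroll x' y' -> eqmod x x' /\ y = y'.
Proof.
move=> vy vy' reg E.
have yy' : y = y' by rewrite -(height_unroll x vy) E height_unroll.
split=> //; move: E; rewrite -yy' => E.
have eqP' (P Q : Prop) : (P <-> Q) -> P = Q by move/propext.
have eqx a b : eqmod a b -> eqmod x a <-> eqmod x b.
  move=> ab; split=> xa; first exact: eqmod_trans ab.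
  by apply: eqmod_trans xa _; apply: eqmod_sym.
have [y0|[y0|nx]] : c0 < y \/ (y < c0 \/ ~ is_node D x).
- by case: (ltgtP c0 y) reg => [||->]; [left|right; left|case=> //; right;
  right].
- have [|||f H] := @descent R X Prop (fun a b => c0 < b /\ eqmod x a)
      (fun a b => c0 < b /\ eqmod x a) _ _ (fun _ _ _ _ => erefl).
  + by move=> a b c ab; apply: eqP'; rewrite (eqx _ _ ab).
  + by move=> a b c ab; apply: eqP'; rewrite (eqx _ _ ab).
  + by move=> a b _ b0; apply: eqP'; split=> -[]; rewrite ltNge b0.
  have := H x y vy; rewrite E; case: (H x' y vy) => -> _ [HE _].
  suff [] : c0 < y /\ eqmod x x' by [].
  by rewrite HE; split=> //; exact: eqmod_refl.
- have [||||f H] := @descent R X Prop (fun a b => b < c0 /\ eqmod x a)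
      (fun a b => b < c0 /\ eqmod x (next a)).
  + by move=> a b c ab; apply: eqP'; rewrite (eqx _ _ ab).
  + by move=> a b c ab; apply: eqP'; rewrite (eqx _ _ (next_eqmod ab)).
  + by move=> a b _ b0; apply: eqP'; split=> -[]; rewrite ltNge b0.
  + by [].
  have := H x y vy; rewrite E; case: (H x' y vy) => -> _ [HE _].
  suff [] : y < c0 /\ eqmod x x' by [].
  by rewrite HE; split=> //; exact: eqmod_refl.
(* Off the nodes the height needs no restriction: [next] preserves nodes and moves every other point
   by one period. *)
have [|||f H] := @descent R X Prop (fun a b => eqmod x a)
    (fun a b => eqmod x a) _ _ (fun _ _ _ _ => erefl).
- by move=> a b c ab; apply: eqP'; rewrite (eqx _ _ ab).
- by move=> a b c ab; apply: eqP'; rewrite (eqx _ _ ab).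
- move=> a b _ _; apply: eqP'; case: (node_cases X a) => [[i ai]|na].
    have na : is_node D a.
      by apply: is_node_eqmod (is_node_right i); apply: eqmod_sym.
    split=> xa; case: nx.
      by apply: is_node_eqmod na; apply: eqmod_sym.
    by apply: (is_node_eqmod (eqmod_sym xa)); apply/is_node_next.
  rewrite next_regular //; apply: eqx.
  by exists (- 1); rewrite mulN1r.
have := H x y vy; rewrite E; case: (H x' y vy) => -> _ [HE _].
by rewrite HE; exact: eqmod_refl.
Qed.

(** A nearby parameter is compared through [unroll] when its abscissa lies to the right and through
    [unroll_left] when it lies to the left; the Lipschitz bounds turn the sizes of the one-sided
    boxes into a radius for the parameter. *)
Lemma continuous_unroll (S : set R) (u v : R -> R) (g : R -> X) (K : R) :
  0 < K ->
  (forall r r', `|u r' - u r| <= K * `|r' - r|) ->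
  (forall r r', `|v r' - v r| <= K * `|r' - r|) ->
  (forall r, S r -> valid (v r)) ->
  (forall r, S r -> exists2 e, 0 < e & forall r', S r' -> `|r' - r| < e ->
     [/\ u r <= u r', g r = unroll (u r) (v r) & g r' = unroll (u r') (v r')] \/
     [/\ u r' <= u r, g r = unroll_left (u r) (v r) &
         g r' = unroll_left (u r') (v r')]) ->
  {within S, continuous g}.
Proof.
move=> K0 Ku Kv Sv H; apply/subspace_continuousP => r Sr W Wr.
have [A [Ao Ar] AW] : exists2 A, open A /\ A (g r) & A `<=` W.
  by move: Wr; rewrite nbhsE => -[A [Ao Ar] AW]; exists A.
have [/(_ _ _ (Sv _ Sr)) Hr /(_ _ _ (Sv _ Sr)) Hl] := proj1 (open_unroll A) Ao.
have [er er0 HR] : exists2 e : R, 0 < e & g r = unroll (u r) (v r) ->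
    forall x' y', u r <= x' < u r + e -> `|y' - v r| < e -> valid y' ->
    A (unroll x' y').
  case: (pselect (g r = unroll (u r) (v r))) => E; last by exists 1.
  by have [|e e0 He] := Hr (u r); [rewrite -E|exists e].
have [el el0 HL] : exists2 e : R, 0 < e & g r = unroll_left (u r) (v r) ->
    forall x' y', u r - e < x' <= u r -> `|y' - v r| < e -> valid y' ->
    A (unroll_left x' y').
  case: (pselect (g r = unroll_left (u r) (v r))) => E; last by exists 1.
  by have [|e e0 He] := Hl (u r); [rewrite -E|exists e].
have [e e0 He] := H r Sr.
rewrite /= /within /=; apply/nbhsRP.
exists (Num.min e (Num.min (er / K) (el / K))).
  by rewrite !lt_min e0 !divr_gt0.
move=> r'; rewrite !lt_min !ltr_pdivlMr // ![_ * K]mulrC.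
move=> /andP[r'e /andP[r'r r'l]] Sr'; apply: (AW (g r')).
have := Ku r r'; have := Kv r r'; rewrite !ler_norml => kv ku.
case: (He r' Sr' r'e) => -[uu E ->].
  by apply: (HR E); rewrite ?ltr_norml; try lra_real; exact: Sv.
by apply: (HL E); rewrite ?ltr_norml; try lra_real; exact: Sv.
Qed.

Lemma connected_path (B : set X) (S : set R) (g : R -> X) r1 r2 :
  is_interval S -> {within S, continuous g} -> (forall r, S r -> B (g r)) ->
  S r1 -> S r2 -> connected_component B (g r1) (g r2).
Proof.
move=> Si gc SB S1 S2.
have := @connected_component_max _ B (g @` S) (g r1); apply; last by exists r2.
- by exists r1.
- by move=> _ [r Sr <-]; exact: SB.
- by apply: connected_continuous_connected gc; apply/connected_intervalP.
Qed.

Lemma continuous_vertical (S : set R) x : S `<=` valid ->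
  {within S, continuous (unroll x)}.
Proof.
move=> Sv; apply: (@continuous_unroll _ (fun=> x) id _ 1) => // [r r'|r r'|r
  Sr].
- by rewrite subrr normr0 mul1r.
- by rewrite mul1r.
- by exists 1 => // r' Sr' _; left.
Qed.

Lemma connected_vertical (B : set X) x y1 y2 : valid y1 -> valid y2 ->
  y1 <= y2 -> (forall y, y1 <= y <= y2 -> B (unroll x y)) ->
  connected_component B (unroll x y1) (unroll x y2).
Proof.
move=> v1 v2 y12 yB; apply: (@connected_path _ `[y1, y2]%classic).
- exact: interval_is_interval.
- by apply: continuous_vertical => y /=; rewrite in_itv /=; apply:
  valid_between.
- by move=> y /=; rewrite in_itv /=; exact: yB.
- by rewrite /= in_itv /= lexx.
- by rewrite /= in_itv /= lexx y12.
Qed.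

(** A node below [c0] is allowed at the left end of [S], where right-continuity of [unroll] is
    enough. *)
Lemma continuous_horizontal (S : set R) y : valid y ->
  (forall x, S x -> (forall x', S x' -> x <= x') \/ c0 <= y \/ ~ is_node D x) ->
  {within S, continuous (unroll^~ y)}.
Proof.
move=> vy reg; apply: (@continuous_unroll _ id (fun=> y) _ 1) => //.
- by move=> r r'; rewrite mul1r.
- by move=> r r'; rewrite subrr normr0 mul1r.
move=> r Sr; have [e e0 He] := not_node_near D r.
exists e => // r' Sr' r'e; case: (leP r r') => rr'; first by left.
right; split; first exact: ltW.
  case: (reg r Sr) => [/(_ r' Sr') ?|]; first by lra_real.
  by case=> [y0|nr]; [rewrite unroll_left_above|rewrite unroll_left_regular].
rewrite unroll_left_regular //; apply: He => // E; lra_real.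
Qed.

Lemma connected_horizontal (B : set X) y x1 x2 : valid y -> x1 <= x2 ->
  c0 <= y \/ (forall x, x1 < x <= x2 -> ~ is_node D x) ->
  (forall x, x1 <= x <= x2 -> B (unroll x y)) ->
  connected_component B (unroll x1 y) (unroll x2 y).
Proof.
move=> vy x12 reg xB.
apply: (@connected_path _ `[x1, x2]%classic (unroll^~ y)).
- exact: interval_is_interval.
- apply: continuous_horizontal => // x /=; rewrite in_itv /= => /andP[].
  rewrite le_eqVlt => /orP[/eqP <- _|xl xr].
    by left=> x' /=; rewrite in_itv /= => /andP[].
  by right; case: reg => [|H]; [left|right; apply: H; rewrite xl].
- by move=> x /=; rewrite in_itv /=; exact: xB.
- by rewrite /= in_itv /= lexx.
- by rewrite /= in_itv /= lexx x12.
Qed.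

End Injectivity.

(** * Planarity *)

Section Planarity.
Variables (R : realType) (X : local_model_surface R).
Local Notation C := ((R[i])^o).
Local Notation tau := (2 * pi : R).
Local Notation D := (lms_rect X).
Local Notation c0 := (c0 D).
Local Notation valid := (valid X).
Local Notation unroll := (unroll X).
Local Notation unroll_left := (unroll_left X).
Local Notation next := (next X).

(* Non-dependent variants of [leP] and [ltP], which do not inspect the goal. *)
Lemma leVlt (x y : R) : x <= y \/ y < x.
Proof. by case: leP; [left|right]. Qed.

Lemma ltVle (x y : R) : x < y \/ y <= x.
Proof. by case: ltP; [left|right]. Qed.

(** A Lipschitz profile that vanishes at the ends of [[a, t]] and whose superlevel sets are
    intervals; a loop of this shape is low only near its ends. *)
Definition tent (a t x : R) : R := Num.min (x - a) (t - x).

Lemma tent_lipschitz a t x x' : `|tent a t x' - tent a t x| <= `|x' - x|.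
Proof.
rewrite /tent /Num.min; case: ltP => h1; case: ltP => h2;
by case: (ger0P (x' - x)) => h3; rewrite ler_norml; lra.
Qed.

Lemma tent_itv a t x : a <= x <= t -> 0 <= tent a t x <= (t - a) / 2.
Proof. by rewrite /tent /Num.min; case: ltP => h1 h2; lra. Qed.

Lemma tent_first a t : a < t -> tent a t a = 0.
Proof. by move=> ta; rewrite /tent subrr; apply/min_idPl; lra. Qed.

Lemma tent_last a t : a < t -> tent a t t = 0.
Proof. by move=> ta; rewrite /tent subrr; apply/min_idPr; lra. Qed.

(** The graph of [psi] over [[next t, t]] closes up because below [c0] the left side of the line
    through [t] is glued to the right side of the line through [next t]. It is simple because the
    interval is no longer than one turn and, strictly between the ends, the graph meets the lines
    through the nodes only above [c0], where [unroll] identifies nothing but periods. *)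
Lemma graph_loop (t K : R) (psi : R -> R) : 0 < K ->
  (forall x x', `|psi x' - psi x| <= K * `|x' - x|) ->
  (forall x, next t <= x <= t -> valid (psi x)) ->
  psi (next t) = psi t -> psi t < c0 ->
  (forall x, next t < x < t -> is_node D x -> c0 < psi x) ->
  exists g : R -> X, [/\ {within `[0, 1], continuous g}, g 0 = g 1,
    set_inj `[0, 1[ g &
    g @` `[0, 1] = [set p | exists2 x, next t <= x < t & p = unroll x (psi x)]].
Proof.
move=> K0 lip psiv psiE psit psin; have /andP[ta at_] := next_itv X t.
have t0 := @tau_gt0 R; set a := next t in psiv psiE psin ta at_ *.
have ta0 : 0 < t - a by rewrite subr_gt0.
have tat : t - a <= tau by lra.
pose u r := a + r * (t - a).
have uB r r' : u r' - u r = (t - a) * (r' - r) by rewrite /u; ring.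
have u0 : u 0 = a by rewrite /u mul0r addr0.
have u1 : u 1 = t by rewrite /u mul1r addrC subrK.
have ler_u r r' : (u r <= u r') = (r <= r').
  by rewrite -subr_ge0 uB pmulr_rge0 // subr_ge0.
have ltr_u r r' : (u r < u r') = (r < r').
  by rewrite -subr_gt0 uB pmulr_rgt0 // subr_gt0.
have u_itv r : 0 <= r <= 1 -> a <= u r <= t by rewrite -u0 -u1 !ler_u.
have u_itvo r : 0 <= r < 1 -> a <= u r < t by rewrite -u0 -u1 ler_u ltr_u.
have u_ex x : a <= x < t -> exists2 r, 0 <= r < 1 & u r = x.
  move=> axt; have E : u ((x - a) / (t - a)) = x.
    by rewrite /u divfK ?gt_eqF // addrC subrK.
  by exists ((x - a) / (t - a)) => //; rewrite -ler_u -ltr_u E u0 u1.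
have regular x : a <= x < t -> psi x <> c0 \/ ~ is_node D x.
  rewrite le_eqVlt => /andP[/orP[/eqP <- _|xa xt]].
    by left; rewrite psiE => ?; lra.
  case: (pselect (is_node D x)) => nx; last by right.
  have : c0 < psi x by apply: psin; rewrite ?xa.
  by left=> ?; lra.
(* At [r = 1] the curve arrives from the left, so its last value must be that of [unroll_left]. *)
pose g r := if r < 1 then unroll (u r) (psi (u r)) else unroll_left t (psi t).
have g_lt r : r < 1 -> g r = unroll (u r) (psi (u r)) by rewrite /g => ->.
have g1 : g 1 = unroll_left t (psi t) by rewrite /g ltxx.
have g01 : g 0 = g 1.
  rewrite g1 g_lt ?ltr01 // u0 psiE unroll_left_below //; last exact: ltW.
  by apply: psiv; rewrite lexx ltW.
exists g; split=> //.
(* [(1 + K) * tau] bounds the Lipschitz constants of both coordinates, as [t - a <= tau]. *)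
- apply: (continuous_unroll (u := u) (v := psi \o u) (K := (1 + K) * tau)).
  + by rewrite mulr_gt0 // addr_gt0.
  + move=> r r'; rewrite uB normrM gtr0_norm //; apply: ler_wpM2r => //.
    apply: le_trans tat _; by rewrite [(1 + K) * _]mulrDl mul1r lerDl mulr_ge0
      // ltW.
  + move=> r r'; apply: le_trans (lip _ _) _; rewrite uB normrM gtr0_norm //.
    rewrite [leLHS]mulrA; apply: ler_wpM2r => //; rewrite [(1 + K) * _]mulrDl
      mul1r.
    apply: le_trans (_ : K * tau <= _); first by rewrite ler_pM2l.
    by rewrite lerDr ltW.
  + by move=> r /=; rewrite in_itv /= => /u_itv; exact: psiv.
  move=> r /=; rewrite in_itv /= => /andP[r0].
  rewrite le_eqVlt => /orP[/eqP ->|r1].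
    have [e e0 He] := not_node_near D t.
    exists (e / (t - a)) => [|r']; first by rewrite divr_gt0.
    rewrite in_itv /= => /andP[r'0 r'1]; rewrite ltr_pdivlMr // mulrC => r'e.
    right; rewrite u1 g1; split=> //; first by rewrite -u1 ler_u.
    move: r'1; rewrite le_eqVlt => /orP[/eqP ->|r'1]; first by rewrite u1 g1.
    rewrite g_lt // unroll_left_regular //; apply: He.
      by rewrite -[X in _ - X]u1 uB normrM gtr0_norm.
    by move=> E; have := ltr_u r' 1; rewrite r'1 E u1 ltxx.
  have [e e0 He] := not_node_near D (u r).
  exists (Num.min (1 - r) (e / (t - a))).
    by rewrite lt_min subr_gt0 r1 divr_gt0.
  move=> r' /=; rewrite in_itv /= lt_min ltr_pdivlMr // mulrC => r'01.
  move=> /andP[/(le_lt_trans (ler_norm _))]; rewrite ltrD2r => r'1 r'e.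
  rewrite !g_lt //; case: (leP r r') => rr'; first by left; rewrite ler_u.
  right; split; first by rewrite ler_u ltW.
    have ur : a <= u r < t by apply: u_itvo; rewrite r0.
    case: (leP c0 (psi (u r))) => [y0|y0].
      by rewrite unroll_left_above //; apply: psiv; case/andP: ur => -> /ltW.
    rewrite unroll_left_regular // => nr.
    have uat : a < u r < t by rewrite -u0 -u1 !ltr_u r1 andbT; lra_real.
    by have := psin _ uat nr; lra_real.
  rewrite unroll_left_regular //; apply: He; first by rewrite uB normrM
    gtr0_norm.
  by move=> E; have := ltr_u r' r; rewrite rr' E ltxx.
- move=> r1 r2; rewrite !inE /= !in_itv /= => r1i r2i.
  rewrite !g_lt; [|by case/andP: r2i|by case/andP: r1i] => E.
  have [|||E' _] := unroll_inj _ _ _ E.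
  + by apply: psiv; have /andP[-> /ltW] := u_itvo _ r1i.
  + by apply: psiv; have /andP[-> /ltW] := u_itvo _ r2i.
  + by apply: regular; exact: u_itvo.
  have : u r1 = u r2.
    have := u_itvo _ r1i; have := u_itvo _ r2i.
    by move=> ? ?; apply: (eqmod_eq E'); rewrite ltr_norml; lra_real.
  by move=> ur; apply/eqP; rewrite eq_le -(ler_u r1) -(ler_u r2) ur lexx.
have H r : 0 <= r < 1 ->
    exists2 x, a <= x < t & g r = unroll x (psi x).
  by move=> r01; exists (u r); [exact: u_itvo|rewrite g_lt; case/andP: r01].
apply/seteqP; split=> [_ [r r01 <-]|_ [x xat ->]].
  move: r01; rewrite /= in_itv /= => /andP[r0].
  rewrite le_eqVlt => /orP[/eqP ->|r1]; last by apply: H; rewrite r0.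
  by rewrite -g01; apply: H; rewrite lexx ltr01.
have [r /andP[r0 r1] <-] := u_ex x xat; exists r; last by rewrite g_lt.
by rewrite /= in_itv /= r0 ltW.
Qed.

(* Otherwise the loop that goes from [next t] to [t] above the node [u] and is
   closed up through the slit below [t] would not separate: the points on both
   sides of it are joined through the common image of [u] and [t]. *)
Lemma planar_next t u : next t < u < t -> unroll u c0 <> unroll t c0.
Proof.
move=> /andP[au ut] E; have /andP[ta at_] := next_itv X t.
set a := next t in au ta at_ *.
have ll := unroll_left_below t (valid_c0 X) (lexx _).
have [e1 e10 He1] := not_node_near D a.
have [e2 e20 He2] := not_node_near D t.
have [e3 e30 He3] := valid_near (valid_c0 X).
have t0 := @tau_gt0 R.
(* Within [2 * dl] of the ends of [[a, t]] there is no node other than possibly the ends, and [u] is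
   at least that far from them. *)
pose dl := Num.min (Num.min e1 e2) (Num.min (u - a) (t - u)) / 2.
have dl0 : 0 < dl by rewrite divr_gt0 // !lt_min e10 e20 /= !subr_gt0 au.
have [d1 d2 d3 d4] : [/\ 2 * dl <= e1, 2 * dl <= e2, 2 * dl <= u - a &
    2 * dl <= t - u].
  have -> : 2 * dl = Num.min (Num.min e1 e2) (Num.min (u - a) (t - u)).
    by rewrite mulrC divfK.
  by split; rewrite !ge_min lexx ?orbT.
have nodes_mid x : a < x < t -> is_node D x -> a + 2 * dl <= x <= t - 2 * dl.
  move=> axt nx; apply/andP; split; rewrite leNgt; apply/negP => H.
    by apply: (He1 x) nx; [rewrite ltr_norml; lra_real|move=> ?; lra_real].
  by apply: (He2 x) nx; [rewrite ltr_norml; lra_real|move=> ?; lra_real].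
(* With slope [k] the curve deviates from [c0] by less than [e3], hence stays within the heights of
   the surface. *)
pose k := e3 / 2 / tau.
have k0 : 0 < k by rewrite !divr_gt0.
have kt : k * tau < e3 by rewrite /k divfK ?gt_eqF //; lra_real.
pose m := tent a t.
(* The curve starts and ends [k * dl] below [c0] and is above [c0] where [m] exceeds [dl], in
   particular over all nodes strictly between [a] and [t]. *)
pose psi x := c0 + k * (m x - dl).
have m_le x : a <= x <= t -> 0 <= m x <= tau / 2.
  by move=> /tent_itv; rewrite -/(m x); lra.
have psi_val x : a <= x <= t -> valid (psi x).
  move=> /m_le mx; apply: He3; rewrite /psi addrC addKr normrM gtr0_norm //.
  apply: le_lt_trans kt; rewrite ler_pM2l // ler_norml.
  have : dl <= tau by lra_real.
  by lra_real.
have psi_top x : a <= x <= t -> psi x < c0 + k * tau.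
  by move=> /m_le mx; rewrite /psi ltrD2l ltr_pM2l //; lra_real.
have psi_gt x : dl < m x -> c0 < psi x.
  by move=> mx; rewrite /psi ltrDl mulr_gt0 // subr_gt0.
have psi_mono x x' : m x <= m x' -> psi x <= psi x'.
  by move=> mx; rewrite /psi lerD2l ler_pM2l // lerD2r.
have ma : m a = 0 by apply: tent_first; lra.
have mt : m t = 0 by apply: tent_last; lra.
have psi_ta : psi t = psi a by rewrite /psi ma mt.
have psi_a : psi a < c0 by rewrite /psi ma gtrDl pmulr_rlt0 // sub0r oppr_lt0.
have psi_reg x : a <= x < t -> psi x <> c0 \/ ~ is_node D x.
  rewrite le_eqVlt => /andP[/orP[/eqP <- _|xa xt]]; first by left=> ?; lra_real.
  case: (pselect (is_node D x)) => nx; last by right.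
  left; suff : c0 < psi x by move=> ? ?; lra_real.
  apply: psi_gt; rewrite /m /tent lt_min.
  have := @nodes_mid x; rewrite xa xt => /(_ isT nx); lra_real.
have psi_lip x x' : `|psi x' - psi x| <= k * `|x' - x|.
  have -> : psi x' - psi x = k * (m x' - m x) by rewrite /psi; ring.
  by rewrite normrM gtr0_norm // ler_pM2l //; exact: tent_lipschitz.
have aE : a = next t by [].
clearbody a dl k psi.
have graph_eq x x' y : a <= x < t -> valid y -> unroll x (psi x) = unroll x' y
  ->
    eqmod x x' /\ psi x = y.
  move=> axt vy; apply: unroll_inj => //; last exact: psi_reg.
  by apply: psi_val; lra_real.
have [||||||g [gc g01 ginj gE]] := @graph_loop t k psi.
- exact: k0.
- exact: psi_lip.
- by move=> x; rewrite -aE; exact: psi_val.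
- by rewrite -aE.
- by rewrite psi_ta.
- move=> x; rewrite -aE => xat nx; apply: psi_gt; rewrite /m /tent lt_min.
  by have := nodes_mid x xat nx; lra_real.
apply: (lms_planar gc g01 ginj); rewrite gE -aE.
have udl : a + 2 * dl <= u <= t - 2 * dl by lra_real.
have dta : 4 * dl <= t - a by lra_real.
have vc := valid_c0 X.
have top : valid (c0 + k * tau).
  by apply: He3; rewrite addrC addKr ger0_norm // mulr_ge0 //; lra_real.
clear g gc g01 ginj gE psi_lip He1 He3 e1 e10 d1 d2 d3 d4 ma mt ll kt.
set B := ~` _.
have inB1 x y : a <= x <= t -> valid y -> psi x <> y -> B (unroll x y).
  move=> axt vy xy [x' ax't /esym E'].
  have [|E1 E2] := graph_eq _ _ _ _ vy E'; first by [].
  apply: xy; rewrite -E2; case: (ltVle x t) => xt.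
    by rewrite (eqmod_eq E1) // ltr_norml; lra_real.
  have -> : x = t by lra_real.
  (* If the window is a full turn, [t] is congruent to [a]; the curve has the same height at
     both. *)
  rewrite psi_ta; case: (ltVle a x') => ax'; last by congr psi; lra_real.
  have xE : x' = x by apply: (eqmod_eq E1); rewrite ltr_norml; lra_real.
  lra_real.
have inB2 x y : t < x < a + tau -> valid y -> B (unroll x y).
  move=> axt vy [x' ax't /esym E'].
  have [|E1 _] := graph_eq _ _ _ _ vy E'; first by [].
  have xE : x' = x by apply: (eqmod_eq E1); rewrite ltr_norml; lra_real.
  lra_real.
have notB x : a <= x < t -> ~ B (unroll x (psi x)) by move=> axt; apply; exists
  x.
clearbody B.
have au_t : a <= u <= t by lra_real.
pose comp := connected_component B (unroll t c0).
(* The assumption [E] enters here: points under the arc reach height [c0], then run along it to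
   [unroll u c0], which is the base point [unroll t c0]. *)
have up x y : a <= x <= t -> valid y -> dl < m x -> y < psi x ->
    comp (unroll x y).
  move=> axt vy mx yx; apply: connected_component_trans (_ : comp (unroll x
    c0)) _.
    rewrite /comp -E; case: (leVlt x u) => xu.
      apply: connected_component_sym; apply: connected_horizontal => //.
        by left.
      move=> x' x'u; apply: inB1 => //; first lra_real.
      suff : c0 < psi x' by move=> ? ?; lra_real.
      by apply: psi_gt; move: mx; rewrite /m /tent !lt_min; lra_real.
    apply: connected_horizontal => //; [exact: ltW|by left|].
    move=> x' x'u; apply: inB1 => //; first lra_real.
    suff : c0 < psi x' by move=> ? ?; lra_real.
    by apply: psi_gt; move: mx; rewrite /m /tent !lt_min; lra_real.
  have cx := psi_gt x mx.
  case: (leVlt y c0) => yc.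
    apply: connected_component_sym; apply: connected_vertical => // y' yy'.
    by apply: inB1 => //; [apply: valid_between vy vc yy'|lra_real].
  apply: connected_vertical => //; first exact: ltW.
  by move=> y' yy'; apply: inB1 => //; [apply: valid_between vc vy
    yy'|lra_real].
have all_comp p : B p -> comp p.
  have [x0 [y [vy ->]]] := unroll_surj p.
  have [x /(unroll_eqmod X y) -> xa Bx] := reduce_mod a x0.
  have xy : a <= x < t -> psi x <> y.
    by move=> axt xy; apply: (notB _ axt); rewrite xy.
  (* No part of the curve lies over the open interval from [t] to [a + tau], so go to height [c0]
     and then along it to [t]. *)
  have right_part x' : t < x' < a + tau -> comp (unroll x' y).
    move=> tx'; apply: connected_component_trans (_ : comp (unroll x' c0)) _.
      apply: connected_horizontal => //; [lra_real|by left|] => x'' x''x.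
      case: (ltVle t x'') => tx''; first by apply: inB2 => //; lra_real.
      have -> : x'' = t by lra_real.
      by apply: inB1 => //; lra_real.
    case: (leVlt c0 y) => yc.
      apply: connected_vertical => // y' yy'; apply: inB2 => //.
      exact: valid_between vc vy yy'.
    apply: connected_component_sym; apply: connected_vertical => //.
      exact: ltW.
    move=> y' yy'; apply: inB2 => //; exact: valid_between vy vc yy'.
  case: (leVlt t x) => tx.
    move: tx; rewrite le_eqVlt => /orP[/eqP tx|tx]; last by apply: right_part;
      lra_real.
    (* Over [t] itself, first step to the right by less than [e2], where no further node is met,
       into the previous case. *)
    pose x' := t + Num.min e2 (a + tau - t) / 2.
    have [xx1 xx2 xx3] : [/\ t < x', x' < t + e2 & x' < a + tau].
      have h0 : 0 < Num.min e2 (a + tau - t) by rewrite lt_min; lra_real.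
      have h1 : Num.min e2 (a + tau - t) <= e2 by rewrite ge_min lexx.
      have h2 : Num.min e2 (a + tau - t) <= a + tau - t.
        by rewrite ge_min lexx orbT.
      by rewrite /x'; split; lra_real.
    apply: connected_component_trans (_ : comp (unroll x' y)) _.
      by apply: right_part; lra_real.
    apply: connected_component_sym; apply: connected_horizontal => //; first
      lra_real.
      right=> x'' x''x; apply: He2; first by rewrite ltr_norml; lra_real.
      by move=> ?; lra_real.
    move=> x'' x''x; case: (ltVle x x'') => xx''; first by apply: inB2 => //;
      lra_real.
    by have -> : x'' = x by lra_real.
  have axt : a <= x <= t by lra_real.
  have xy' : psi x <> y by apply: xy; lra_real.
  have [{}xy'|yx] : psi x < y \/ y < psi x by apply/orP; rewrite -neq_lt;
    apply/eqP.
    (* Above the curve: climb to a height [y1] that clears it, cross over to [t] and come down. *)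
    pose y1 := Num.max y (c0 + k * tau).
    have y1y : y <= y1 by rewrite le_max lexx.
    have y1t : c0 + k * tau <= y1 by rewrite le_max lexx orbT.
    have vy1 : valid y1 by rewrite /y1 /Num.max; case: ifP.
    have kt0 : 0 < k * tau by rewrite mulr_gt0.
    apply: connected_component_trans (_ : comp (unroll t y1)) _.
      apply: connected_vertical => //; first lra_real.
      move=> y' yy'; apply: inB1; [lra_real|exact: valid_between vc vy1
        yy'|lra_real].
    apply: connected_component_trans (_ : connected_component B _ (unroll x
      y1)) _.
      apply: connected_component_sym; apply: connected_horizontal => //.
      - exact: ltW.
      - by left; lra_real.
      move=> x' x'x; apply: inB1 => //; first lra_real.
      have : psi x' < c0 + k * tau by apply: psi_top; lra_real.
      lra_real.
    apply: connected_component_sym; apply: connected_vertical => // y' yy'.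
    by apply: inB1 => //; [apply: valid_between vy vy1 yy'|lra_real].
  case: (ltVle dl (m x)) => mx; first exact: up.
  (* Under the curve near an end: slide to distance [3 / 2 * dl] from that end, past [dl] so that
     [up] applies and short of [2 * dl] so that no node is crossed. On the way the curve does not
     drop below its starting height. *)
  have [xl|xr] : x - a <= dl \/ t - x <= dl.
    by move: mx; rewrite /m /tent ge_min => /orP.
    apply: connected_component_trans (_ : comp (unroll (a + 3 / 2 * dl) y)) _.
      have mx2 : dl < m (a + 3 / 2 * dl) by rewrite /m /tent lt_min; lra_real.
      apply: up => //; [lra_real|].
      apply: lt_le_trans yx _; apply: psi_mono; lra_real.
    apply: connected_component_sym; apply: connected_horizontal => //; first
      lra_real.
      right=> x' x'x nx'; have x'at : a < x' < t by lra_real.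
      by have := nodes_mid _ x'at nx'; lra_real.
    move=> x' x'x; apply: inB1 => //; first lra_real.
    suff : psi x <= psi x' by lra_real.
    by apply: psi_mono; rewrite /m /tent le_min !ge_min; lra_real.
  apply: connected_component_trans (_ : comp (unroll (t - 3 / 2 * dl) y)) _.
    have mx2 : dl < m (t - 3 / 2 * dl) by rewrite /m /tent lt_min; lra_real.
    apply: up => //; [lra_real|].
    apply: lt_le_trans yx _; apply: psi_mono; lra_real.
  apply: connected_horizontal => //; first lra_real.
    right=> x' x'x nx'; have x'at : a < x' < t by lra_real.
      by have := nodes_mid _ x'at nx'; lra_real.
  move=> x' x'x; apply: inB1 => //; first lra_real.
  suff : psi x <= psi x' by lra_real.
  by apply: psi_mono; rewrite /m /tent le_min !ge_min; lra_real.
rewrite (_ : B = comp); first exact: component_connected.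
by apply/seteqP; split=> [p|]; [exact: all_comp|exact: connected_component_sub].
Qed.

End Planarity.

(** * Holomorphic charts *)

Section Charts.
Variable R : realType.
Local Notation C := ((R[i])^o).
Implicit Types (X Y : riemann_surface R).

Lemma derivable_shift (g : C -> C) (a w : C) :
  derivable g (w + a) 1 -> derivable (fun z => g (z + a)) w 1.
Proof.
have E : (fun h : R[i] => h^-1 *: (((fun z => g (z + a)) \o shift w)
      (h *: (1 : C)) - g (w + a))) = (fun h => h^-1 *:
      ((g \o shift (w + a)) (h *: (1 : C)) - g (w + a))).
  by apply/funext => h /=; rewrite addrA.
by rewrite /derivable E.
Qed.

Lemma shift_continuous (a : C) : continuous (fun w : C => w + a).
Proof.
move=> w A /nbhsCP[e e0 He]; apply/nbhsCP; exists e => // z z1 z2.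
by apply: He; case: (a) (w) (z) z1 z2 => ? ? [? ?] [? ?] /=;
  rewrite opprD addrACA subrr addr0.
Qed.

Lemma nbhs_addr (a w : C) (P : set C) : nbhs (w + a) P ->
  \forall z \near w, P (z + a).
Proof. exact: (@shift_continuous a w P). Qed.

Lemma chart_image_nbhs (T : topologicalType) (c : chart R T) p (W : set T) :
  is_chart c -> chart_dom c p -> nbhs p W ->
  \forall w \near c p, exists p', [/\ chart_dom c p', W p' & c p' = w].
Proof.
case=> co _ _ cA cp; rewrite nbhsE => -[A [Ao Ap] AW].
have Bo : open (c @` (A `&` chart_dom c) : set C).
  by apply: cA; [exact: openI|move=> ? []].
have : nbhs (c p) (c @` (A `&` chart_dom c) : set C).
  by apply: open_nbhs_nbhs; split=> //; exists p.
by apply: filterS => w [p' [Ap' cp'] <-]; exists p'; split=> //; exact: AW.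
Qed.

Lemma chart_preimage_nbhs (T : topologicalType) (c : chart R T) p
    (V : set C) : is_chart c -> chart_dom c p -> nbhs (c p) V ->
  \forall p' \near p, chart_dom c p' /\ V (c p').
Proof.
case=> _ _ cV _ cp; rewrite nbhsE => -[A [Ao Ap] AV].
have : nbhs p (chart_dom c `&` c @^-1` A).
  by apply: open_nbhs_nbhs; split; [exact: cV|].
by apply: filterS => p' [? Ap']; split=> //; exact: AV.
Qed.

Lemma deriv_in_uniq (T : topologicalType) (c : chart R T) u p a b :
  is_chart c -> chart_dom c p -> deriv_in c u p a -> deriv_in c u p b -> a = b.
Proof.
move=> hc cp [g1 [ug1 d1]] [g2 [ug2 d2]].
have E : \forall w \near c p, g1 w = g2 w.
  apply: filterS (chart_image_nbhs hc cp (filterI ug1 ug2)) => w.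
  by case=> p' [_ [/= E1 E2] <-]; rewrite -E1 -E2.
have [_ <-] := d2; have [_ <-] := d1.
exact: near_eq_derive.
Qed.

(** Cuts an atlas chart down to the preimage of a disk inside its image and translates it to the
    origin, the shape that [branched_cover] asks for. *)
Lemma centered_coordinate X (x : X) : exists (c : chart R X) (r : R),
  [/\ coordinate c, chart_dom c x, c x = 0 & c @` chart_dom c = disk r].
Proof.
have [c ac cx] := rs_cover x.
have hc := rs_chart ac; have [co cinj cV cA] := hc.
have : nbhs (c x) (c @` chart_dom c : set C).
  by apply: open_nbhs_nbhs; split; [exact: cA|exists x].
move=> /nbhs_ballP[e /= /gt0_realC[r r0 ->] ball_c].
pose B : set C := ball (c x) r%:C.
have Bo : open B by exact: ball_open.
have BE w : B w <-> disk r (w - c x).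
  by rewrite /B -ball_normE /disk /= distrC.
pose c' := Chart (chart_dom c `&` c @^-1` B) (fun p => c p - c x : C).
have hc' : is_chart c'.
  split=> [|p p'|V Vo|A Ao Ac]; first exact: cV.
  - rewrite !inE => -[cp _] [cp' _] /addIr.
    by apply: cinj; rewrite inE.
  - rewrite (_ : _ `&` _ =
        chart_dom c `&` c @^-1` (B `&` (fun w => w - c x) @^-1` V)).
      apply: cV; apply: openI => //; apply: open_comp => // w _.
      exact: shift_continuous.
    by apply/seteqP; split=> p /=; tauto.
  rewrite (_ : _ @` A = (fun w => w + c x) @^-1` (c @` A)).
    apply: open_comp => [w _|]; first exact: shift_continuous.
    by apply: cA => // p /Ac[].
  apply/seteqP; split=> w /=.
    by case=> p Ap <-; exists p; rewrite ?subrK.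
  by case=> p Ap E; exists p; rewrite // E addrK.
exists c', r; split.
- split=> // c1 ac1 p [cp Bp] c1p; have [[g [ug dg]] [g' [ug' dg']]] :=
    rs_compat ac ac1 cp c1p.
  split.
    exists (fun w => g (w + c x)); split.
      by apply: filterS ug => p' ->; rewrite /= subrK.
    have E : c' p + c x = c p by exact: subrK.
    move: dg; rewrite -E => /nbhs_addr.
    by apply: filterS => w; exact: derivable_shift.
  exists (fun w => g' w - c x); split.
    by apply: filterS ug' => p' /= ->.
  apply: filterS dg' => w dw.
  exact: (@derivableB _ _ _ g' (cst (c x)) w 1 dw (derivable_cst _ _ _)).
- by split=> //; rewrite /= /B; apply: ballxx; rewrite ltcR.
- by rewrite /= subrr.
apply/seteqP; split=> [w [p [cp /BE Bp] <-] //|w wr].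
have [p cp E] : (c @` chart_dom c) (w + c x) by apply: ball_c; apply/BE;
  rewrite addrK.
by exists p; rewrite /= ?E ?addrK //; split=> //=; apply/BE; rewrite addrK.
Qed.

End Charts.

Section RootCharts.
Variables (R : realType) (X : local_model_surface R).
Local Notation C := ((R[i])^o).

(** By [lms_form_dz] the form is the differential of the flat coordinate, which here is a power of
    the chart. *)
Lemma form_root_chart (c : chart R X) (k : nat) p : rs_atlas c ->
  translation_coordinate (@lms_proj R X) (chart_dom c) (fun p => c p ^+ k) ->
  chart_dom c p -> lms_form c p = k%:R * c p ^+ k.-1.
Proof.
move=> ac tc cp; have hc := rs_chart ac; have [co _ _ _] := hc.
apply: (deriv_in_uniq hc cp (lms_form_dz co tc ac cp cp)).
exists (fun w => w ^+ k); split; first by near=> p'.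
have := @is_deriveX _ _ (id : C -> C) k (c p) 1 1 (is_derive_id _ _).
rewrite /GRing.scale /= mulr1; apply: near_eq_is_derive.
by near=> w; rewrite fctE.
Unshelve. all: by end_near. Qed.

Lemma root_chart_at (p : X) : exists (c : chart R X) (k : nat),
  [/\ rs_atlas c, chart_dom c p, is_chart c, (0 < k)%N &
      translation_coordinate (@lms_proj R X) (chart_dom c) (fun p => c p ^+ k)].
Proof.
have [c ac cp] := rs_cover p; have /lms_atlas[hc [k k0 tc]] := ac.
by exists c, k.
Qed.

End RootCharts.

(** * Isomorphisms from shifts *)

Section CentralLeaf.
Variables (R : realType) (X : local_model_surface R).

Lemma central_leafE (p : X) : central_leaf p <-> height p = c0 (lms_rect X).
Proof.
split.
  move=> [i [[x y] [/columnE[/andP[xl xr] vy] /= y0 ->]]]; rewrite -y0.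
  move: xr; rewrite le_eqVlt => /orP[/eqP ->|xr].
    by rewrite -unroll_right_node height_unroll_left.
  rewrite -(@unrollE _ _ x x) ?height_unroll ?xl //; exact: eqmod_refl.
have [x [y [vy ->]]] := unroll_surj p; rewrite height_unroll // => y0.
have [[i k] /= xi] := column_ex (lms_rect X) x.
exists i, ((x + k%:~R * (2 * pi)) +i* y); split=> //.
  by apply/columnE; split=> //; lra.
by apply: unrollE => //; exists k.
Qed.

End CentralLeaf.

Section Shift.
Variable R : realType.
Local Notation C := ((R[i])^o).
Implicit Types X : local_model_surface R.

(* [theta] matches the gluing data of [X] and [X'], once heights are measured
   from the central leaves. *)
Definition shiftable X X' (theta : R) : Prop :=
  (forall y, valid X y <-> valid X' (y - c0 (lms_rect X) + c0 (lms_rect X'))) /\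
  (forall x, next X' (x + theta) = next X x + theta).

Definition is_shift X X' (theta : R) (f : X -> X') : Prop :=
  forall x y, valid X y ->
    f (unroll X x y) =
      unroll X' (x + theta) (y - c0 (lms_rect X) + c0 (lms_rect X')) /\
    f (unroll_left X x y) =
      unroll_left X' (x + theta) (y - c0 (lms_rect X) + c0 (lms_rect X')).

Lemma shiftable_sym X X' theta : shiftable X X' theta -> shiftable X' X (-
  theta).
Proof.
case=> hv hn; split=> [y|x].
  by rewrite hv; have -> : y - c0 (lms_rect X') + c0 (lms_rect X) -
    c0 (lms_rect X) + c0 (lms_rect X') = y by ring.
by have := hn (x - theta); rewrite subrK => ->; rewrite addrK.
Qed.

(** Translation by [theta] commutes with [next], which is the compatibility below [c0] that
    [descent] asks for. *)
Lemma shift_ex X X' theta : shiftable X X' theta ->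
  exists f : X -> X', is_shift theta f.
Proof.
move=> [hv hn]; apply: (descent
  (G := fun x y => unroll X' (x + theta) (y - c0 (lms_rect X) + c0 (lms_rect
    X')))
  (Gl := fun x y =>
     unroll_left X' (x + theta) (y - c0 (lms_rect X) + c0 (lms_rect X')))).
- by move=> x x' y xx'; apply: unroll_eqmod; exact: eqmodD.
- by move=> x x' y xx'; apply: unroll_left_eqmod; exact: eqmodD.
- by move=> x y /hv vy y0; apply: unroll_left_above => //; lra.
- by move=> x y /hv vy y0; rewrite unroll_left_below ?hn //; lra.
Qed.

Lemma is_shift_cancel X X' theta (f : X -> X') (g : X' -> X) :
  shiftable X X' theta -> is_shift theta f -> is_shift (- theta) g -> cancel f
    g.
Proof.
move=> [hv hn] hf hg p; have [x [y [vy ->]]] := unroll_surj p.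
case: (hf x y vy) => -> _; move/hv: vy => /(hg (x + theta)) [-> _].
by rewrite addrK; congr (unroll X _ _); ring.
Qed.

Section Transport.
Variables (X X' : local_model_surface R) (theta : R).
Variables (f : X -> X') (g : X' -> X).
Hypotheses (ok : shiftable X X' theta) (hf : is_shift theta f).
Local Notation dc := (c0 (lms_rect X') - c0 (lms_rect X)).

Lemma near_right_shift x y (P : R -> R -> Prop) :
  near_right X' (x + theta) (y - c0 (lms_rect X) + c0 (lms_rect X')) P ->
  near_right X x y (fun x' y' =>
    P (x' + theta) (y' - c0 (lms_rect X) + c0 (lms_rect X'))).
Proof.
have [hv _] := ok; case=> e e0 H; exists e => // x' y' xx' yy' /hv vy'.
apply: H => //; first lra.
by rewrite (_ : _ - (y - _ + _) = y' - y) //; ring.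
Qed.

Lemma near_left_shift x y (P : R -> R -> Prop) :
  near_left X' (x + theta) (y - c0 (lms_rect X) + c0 (lms_rect X')) P ->
  near_left X x y (fun x' y' =>
    P (x' + theta) (y' - c0 (lms_rect X) + c0 (lms_rect X'))).
Proof.
have [hv _] := ok; case=> e e0 H; exists e => // x' y' xx' yy' /hv vy'.
apply: H => //; first lra.
by rewrite (_ : _ - (y - _ + _) = y' - y) //; ring.
Qed.

Lemma shift_continuous_map : continuous f.
Proof.
have [hv _] := ok.
apply/continuousP => A /open_unroll[Ar Al]; apply/open_unroll.
split=> x y vy; have [/= E1 E2] := hf x vy; rewrite /preimage /= (E1, E2).
  move=> /Ar -/(_ (proj1 (hv y) vy)) /near_right_shift[e e0 H].
  exists e => // x' y' xx' yy' vy'; have [-> _] := hf x' vy'; exact: H.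
move=> /Al -/(_ (proj1 (hv y) vy)) /near_left_shift[e e0 H].
exists e => // x' y' xx' yy' vy'; have [_ ->] := hf x' vy'; exact: H.
Qed.

Lemma shift_translation (U : set X') (zeta : X' -> C) :
  translation_coordinate (@lms_proj R X') U zeta ->
  translation_coordinate (@lms_proj R X) (f @^-1` U) (zeta \o f).
Proof.
have [hv _] := ok.
move=> /translation_unroll[Hr Hl]; apply/translation_unroll.
split=> x y vy; have [/= E1 E2] := hf x vy; rewrite /preimage /= (E1, E2).
  move=> /Hr -/(_ (proj1 (hv y) vy)) /near_right_shift[e e0 H].
  exists e => // x' y' xx' yy' vy'; have [-> _] := hf x' vy'.
  by rewrite H //; congr (_ +i* _); ring.
move=> /Hl -/(_ (proj1 (hv y) vy)) /near_left_shift[e e0 H].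
exists e => // x' y' xx' yy' vy'; have [_ ->] := hf x' vy'.
by rewrite H //; congr (_ +i* _); ring.
Qed.

Hypotheses (fK : cancel f g) (gK : cancel g f) (gc : continuous g).

Definition shift_chart (c : chart R X') : chart R X :=
  Chart (f @^-1` chart_dom c) (c \o f).

Lemma shift_is_chart c : is_chart c -> is_chart (shift_chart c).
Proof.
have fc := shift_continuous_map.
case=> co cinj cV cA; split=> [|p p'|V Vo|A Ao Ac].
- by apply: open_comp => // ? _; exact: fc.
- rewrite !inE => cp cp' E; apply: (can_inj fK); apply: cinj; rewrite ?inE //.
- rewrite (_ : _ `&` _ = f @^-1` (chart_dom c `&` c @^-1` V)) //.
  by apply: open_comp => [? _|]; [exact: fc|exact: cV].
rewrite (_ : _ @` A = c @` (g @^-1` A)).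
  apply: cA => [|p /= /Ac /=]; last by rewrite gK.
  by apply: open_comp => // ? _; exact: gc.
apply/seteqP; split=> w [p Ap <-].
  by exists (f p); rewrite //= fK.
by exists (g p); rewrite //= gK.
Qed.

(** The shift is a translation in the flat coordinates, so a root chart pulls back to a root chart
    with the same exponent, and the atlas contains all of these. This is what makes the shift
    holomorphic. *)
Lemma shift_atlas c : rs_atlas c -> rs_atlas (shift_chart c).
Proof.
move=> /lms_atlas[hc [k k0 tc]]; apply/lms_atlas; split.
  exact: shift_is_chart.
by exists k => //; exact: (shift_translation tc).
Qed.

Lemma shift_holomorphic : holomorphic f.
Proof.
split=> [|c c' p ac ac' cp c'p]; first exact: shift_continuous_map.
by have [] := rs_compat ac (shift_atlas ac') cp c'p.
Qed.

Lemma holo_fun_at_shift (c : chart R X') (u : X' -> C) p :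
  holo_fun_at c u (f p) -> holo_fun_at (shift_chart c) (u \o f) p.
Proof.
move=> [h [uh dh]]; exists h; split=> //.
exact: (shift_continuous_map uh).
Qed.

End Transport.

Lemma shift_central X X' theta (f : X -> X') : shiftable X X' theta ->
  is_shift theta f -> f @` @central_leaf R X `<=` @central_leaf R X'.
Proof.
move=> [hv _] hf _ [p /central_leafE hp <-]; apply/central_leafE.
have [x [y [vy pE]]] := unroll_surj p; move: hp; rewrite pE height_unroll // =>
  yE.
have [-> _] := hf x y vy; rewrite height_unroll; last by apply/hv.
by rewrite yE subrr add0r.
Qed.

Lemma shift_isomorphism X X' theta (f : X -> X') : shiftable X X' theta ->
  is_shift theta f -> isomorphism f.
Proof.
move=> ok hf; have ok' := shiftable_sym ok; have [g hg] := shift_ex ok'.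
have fK := is_shift_cancel ok hf hg.
have gK : cancel g f.
  by apply: (is_shift_cancel ok' hg); rewrite opprK.
have fc := shift_continuous_map ok hf.
have gc := shift_continuous_map ok' hg.
have fh := shift_holomorphic ok hf fK gK gc.
split.
- split=> // x; have [c [r [[hc cc] cx cx0 cr]]] := centered_coordinate x.
  have r0 : 0 < r.
    have : disk r (c x) by rewrite -cr; exists x.
    by rewrite cx0 /disk /= normr0 ltcR.
  (* An unramified cover with one sheet: the pulled-back disk, with exponent [1]. *)
  exists c, r, 1%N, (fun=> shift_chart f c), (fun=> r), (fun=> 1%N).
  split=> //.
  + move=> _; split=> //.
    * split=> [|c1 ac1 p cp c1p]; first exact: (shift_is_chart ok hf fK gK gc
      hc).
      have := shift_atlas ok' hg gK fK fc ac1.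
      move=> /cc H; have [|H1 H2] := H (f p) cp; first by rewrite /= fK.
      (* Compatibility is checked in the target; [c1] is recovered as the pullback by [f] of its
         pullback by [g]. *)
      have E : c1 = shift_chart f (shift_chart g c1).
        rewrite /shift_chart; case: c1 ac1 c1p H H1 H2 => d m ? ? ? ? ? /=.
        by congr Chart; apply/funext => z /=; rewrite /preimage /= fK.
      split; rewrite E.
        exact: (holo_fun_at_shift ok hf H1).
      exact: (holo_fun_at_shift ok hf H2).
    * rewrite -cr; apply/seteqP; split=> w [p cp <-]; first by exists (f p).
      by exists (g p); rewrite //= gK.
  + by apply/seteqP; split=> p /=; [exists ord0|case].
  + by move=> i j _ _ _; rewrite !ord1.
  + by rewrite big_ord1.
- move=> c c' p a ac ac' cp c'p da; rewrite invr1 mul1r.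
  have ac'' := shift_atlas ok hf fK gK gc ac'.
  have [_ H] := lms_form_holo X.
  rewrite (H c (shift_chart f c') p a ac ac'' cp c'p da); congr (_ * _).
  have /lms_atlas[_ [k k0 tc]] := ac'.
  rewrite (form_root_chart ac' tc) //.
  by rewrite (form_root_chart ac'' (shift_translation ok hf tc)).
apply/seteqP; split; first exact: shift_central ok hf.
move=> p cp; exists (g p); last by rewrite gK.
by apply: (shift_central ok' hg); exists p.
Qed.

End Shift.

(** * The lamination and the heights determine the surface *)

Section Classification.
Variable R : realType.
Implicit Types X : local_model_surface R.

Lemma leaf_pointE X t p : leaf_point t p <-> p = unroll X t (c0 (lms_rect X)).
Proof.
split=> [[i [k [/= /andP[xl xr] ->]]]|->].
  have E : eqmod t (t + k%:~R * (2 * pi)) by exists k.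
  move: xr; rewrite (unroll_eqmod _ _ E) le_eqVlt => /orP[/eqP xr|xr].
    rewrite -unroll_left_above ?lexx //; last exact: valid_c0.
    by rewrite {2}xr unroll_right_node -xr.
  by symmetry; apply: unrollE; [exact: eqmod_refl|rewrite xl].
have [[i k] /= xi] := column_ex (lms_rect X) t.
exists i, k => /=; split; first lra.
by apply: unrollE => //; exists k.
Qed.

Lemma associated_laminationE X L : associated_lamination X L -> forall s t,
  L s t <-> unroll X s (c0 (lms_rect X)) = unroll X t (c0 (lms_rect X)).
Proof.
move=> XL s t; rewrite XL; split=> [[p [/leaf_pointE <- /leaf_pointE]] //|E].
by exists (unroll X s (c0 (lms_rect X))); split; apply/leaf_pointE.
Qed.

Lemma lt_subE (c y : R) (h : \bar R) :
  (y%:E < h)%E = ((y - c)%:E < h - c%:E)%E.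
Proof. by case: h => [r| |]; rewrite -?EFinB ?lte_fin ?ltrD2r ?ltry ?ltNyr. Qed.

Lemma lt_subEl (c y : R) (h : \bar R) :
  (h < y%:E)%E = (c%:E - h > (c - y)%:E)%E.
Proof.
by case: h => [r| |]; rewrite -?EFinB ?lte_fin ?ltrD2l ?ltrN2 ?ltry ?ltNyr.
Qed.

Lemma valid_heights X X' : outer_height X = outer_height X' ->
  inner_height X = inner_height X' -> forall y,
  valid X y <-> valid X' (y - c0 (lms_rect X) + c0 (lms_rect X')).
Proof.
rewrite /outer_height /inner_height => ho hi y; rewrite /valid.
rewrite (lt_subE (c0 (lms_rect X)) y) ho (lt_subEl (c0 (lms_rect X)) y) hi.
rewrite [X in _ <-> is_true (_ && X)](lt_subE (c0 (lms_rect X'))) addrK.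
rewrite [X in _ <-> is_true (X && _)](lt_subEl (c0 (lms_rect X'))).
by have -> : c0 (lms_rect X') - (y - c0 (lms_rect X) + c0 (lms_rect X')) =
  c0 (lms_rect X) - y by ring.
Qed.

(** At height [c0] both gluings apply: [unroll_left] at [t] agrees with [unroll] at [t] and with
    [unroll] at [next X t]. *)
Lemma next_class X t : unroll X (next X t) (c0 (lms_rect X)) =
  unroll X t (c0 (lms_rect X)).
Proof.
by rewrite -unroll_left_below ?unroll_left_above ?lexx //; exact: valid_c0.
Qed.

(* The lamination determines the gluing: [next t] is the last point before [t]
   that is equivalent to it. *)
Lemma next_lamination X X' L L' theta :
  associated_lamination X L -> associated_lamination X' L' ->
  (forall s t, L s t <-> L' (s + theta) (t + theta)) ->
  forall t, next X' (t + theta) = next X t + theta.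
Proof.
move=> /associated_laminationE XL /associated_laminationE XL' LL' t.
have := next_itv X t; have := next_itv X' (t + theta).
set a := next X t; set a' := next X' (t + theta) => ha' ha.
have la : L a t by apply/XL; exact: next_class.
have la' : L (a' - theta) t.
  by apply/LL'; rewrite subrK; apply/XL'; exact: next_class.
(* If the two differ, the larger one lies strictly between the smaller one and [t + theta] while in
   the same class, which [planar_next] forbids. *)
case: (ltgtP a' (a + theta)) => // aa'.
  have H : next X' (t + theta) < a + theta < t + theta by rewrite -/a'; lra.
  by have := planar_next H; case; apply/XL'/LL'.
have H : next X t < a' - theta < t by rewrite -/a; lra.
by have := planar_next H; case; apply/XL.
Qed.

Lemma lamination_isomorphism X X' L L' :
  associated_lamination X L -> associated_lamination X' L' ->
  lamination_equiv L L' -> outer_height X = outer_height X' ->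
  inner_height X = inner_height X' -> exists f : X -> X', isomorphism f.
Proof.
move=> XL XL' [theta LL'] ho hi.
have ok : shiftable X X' theta.
  by split; [exact: valid_heights|exact: (next_lamination XL XL' LL')].
by have [f hf] := shift_ex ok; exists f; apply: shift_isomorphism ok hf.
Qed.

End Classification.

(** * The local form of local model maps *)

Section ZeroDerivative.
Variable R : realType.
Local Notation C := ((R[i])^o).

Lemma is_derive0_small (F : C -> C) (z : C) (e : R) : is_derive z 1 F 0 ->
  0 < e -> exists2 d : R, 0 < d & forall k : C,
    `|complex.Re k| < d -> `|complex.Im k| < d ->
    `|F (k + z) - F z| <= e%:C * `|k|.
Proof.
move=> [dF DF] e0; move: dF DF; rewrite /derivable /derive /=.
set G := fun h : R[i] => _; set G0 := _ @ _ => dF DF.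
have : G0 --> (0 : C) by rewrite -DF; exact: dF.
rewrite /G0 {G0 dF DF}.
move=> /cvgrPdist_le /(_ e%:C); rewrite ltcR => /(_ e0).
move=> /nbhsCP[d d0 H]; exists d => // k k1 k2.
have [->|k0] := eqVneq k 0; first by rewrite add0r subrr !normr0 mulr0.
have := H k; rewrite /= !subr0 => /(_ k1 k2 k0).
rewrite sub0r normrN /G /GRing.scale /= mulr1 normrM normfV.
by rewrite mulrC ler_pdivrMr // normr_gt0.
Qed.

(** [proj] stands for the real or the imaginary part; being a contraction, it carries small
    difference quotients of [F] to small real ones. *)
Lemma is_derive0_line (proj : C -> R) (F : C -> C) (z v : C) (t : R) :
  (forall a b, (`|proj a - proj b|)%:C <= `|a - b|) ->
  is_derive (t%:C * v + z : C) 1 F 0 ->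
  is_derive t 1 (fun s : R => proj (F (s%:C * v + z))) 0.
Proof.
move=> proj_le dF; set phi := fun s : R => _.
have [N N0 vN] : exists2 N : R, 0 <= N & `|v| = N%:C.
  by rewrite normc_def; eexists; last reflexivity; exact: sqrtr_ge0.
suff cv : (fun h : R => h^-1 *: ((phi \o shift t) (h *: (1 : R)) - phi t))
    @ (0 : R)^' --> (0 : R).
  by apply: DeriveDef; [exact: cvgP cv|exact: cvg_lim cv].
apply/cvgrPdist_le => e e0.
(* Dividing by [N + 1] instead of [N] covers the case [v = 0]. *)
have N1 : 0 < N + 1 by lra.
have [|d d0 H] := is_derive0_small dF (e := e / (N + 1)); first exact: divr_gt0.
apply/nbhsRP; exists (d / (N + 1)) => [|h]; first exact: divr_gt0.
rewrite subr0 ltr_pdivlMr // => hd h0 /=; rewrite sub0r normrN /GRing.scale /=.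
rewrite mulr1 normrM normfV mulrC ler_pdivrMr ?normr_gt0 //.
have vh : `|h%:C * v| = (`|h| * N)%:C.
  rewrite normrM vN rmorphM /=; congr (_ * _).
  by rewrite normc_def /= expr0n /= addr0 sqrtr_sqr.
have hN : `|h| * N < d by apply: le_lt_trans hd; rewrite ler_wpM2l //; lra.
have := H (h%:C * v); rewrite vh.
have E : h%:C * v + (t%:C * v + z) = (h + t)%:C * v + z.
  by rewrite rmorphD /= mulrDl addrA.
rewrite E => HH; rewrite -lecR; apply: le_trans (proj_le _ _) _.
apply: le_trans (HH _ _) _.
- by rewrite -ltcR; apply: le_lt_trans (normc_ge_Re _) _; rewrite vh ltcR.
- by rewrite -ltcR; apply: le_lt_trans (normC_ge_Im _) _; rewrite vh ltcR.
rewrite -rmorphM lecR /=.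
have -> : e / (N + 1) * (`|h| * N) = e * `|h| * (N / (N + 1)) by ring.
rewrite ler_piMr ?mulr_ge0 //; first exact: ltW.
by rewrite ler_pdivrMr // mul1r; lra.
Qed.

(** The mean value theorem on the segment from [w0] to [w], which stays in the square, applied to
    the real and the imaginary part. *)
Lemma locally_constant (F : C -> C) (w0 : C) :
  (\forall w \near w0, is_derive (w : C) (1 : C) F 0) -> \forall w \near w0, F
    w = F w0.
Proof.
move=> /nbhsCP[e e0 H]; apply/nbhsCP; exists e => // w w1 w2.
have dF (t : R) : 0 <= t <= 1 -> is_derive (t%:C * (w - w0) + w0 : C) 1 F 0.
  move=> t01; apply: H; case: (w) (w0) w1 w2 => a b [a0 b0] /=.
    rewrite mul0r subr0 addrK normrM => ? _.
    by apply: le_lt_trans (ler_piMl (normr_ge0 _) _) _ => //; rewrite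
      ger0_norm; lra.
  rewrite mul0r addr0 addrK normrM => _ ?.
  by apply: le_lt_trans (ler_piMl (normr_ge0 _) _) _ => //; rewrite ger0_norm;
    lra.
have main (proj : C -> R) : (forall a b, (`|proj a - proj b|)%:C <= `|a - b|) ->
    proj (F w) = proj (F w0).
  move=> proj_le.
  have dphi (t : R) : 0 <= t <= 1 -> is_derive t 1
      (fun s : R => proj (F (s%:C * (w - w0) + w0))) 0.
    by move=> /dF; exact: is_derive0_line.
  have [t||c _] := @MVT_segment R (fun s : R =>
    proj (F (s%:C * (w - w0) + w0))) (fun=> 0) 0 1 ler01.
  - by move=> t01; apply: dphi; rewrite in_itv /= in t01; lra.
  - apply: derivable_within_continuous => t; rewrite in_itv /= => /dphi.
    by case.
  by rewrite mul0r mul1r subrK mul0r add0r => /eqP; rewrite subr_eq0 => /eqP.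
apply/eqP; rewrite eq_complex; apply/andP; split; apply/eqP.
  apply: main => a b; apply: le_trans (normc_ge_Re _).
  by case: a b => ? ? [].
apply: main => a b; apply: le_trans (normC_ge_Im _).
by case: a b => ? ? [].
Qed.

End ZeroDerivative.

Section LocalForm.
Variables (R : realType) (Y X : local_model_surface R) (d : nat) (f : Y -> X).
Local Notation C := ((R[i])^o).
Hypotheses (d0 : (0 < d)%N) (fh : holomorphic f).
Hypothesis fp : is_scaled_pullback (d%:R^-1) f (@lms_form R Y) (@lms_form R X).

(** In the coordinate [c] the equation of forms reads [k' g^(k'-1) g' = d k w^(k-1)], so
    [g^k' - d w^k] has zero derivative and is locally constant. The zeros of the forms need no
    separate treatment. *)
Lemma local_form p (c : chart R Y) (c' : chart R X) (k k' : nat) :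
  rs_atlas c -> rs_atlas c' -> chart_dom c p -> chart_dom c' (f p) ->
  translation_coordinate (@lms_proj R Y) (chart_dom c) (fun p => c p ^+ k) ->
  translation_coordinate (@lms_proj R X) (chart_dom c') (fun p => c' p ^+ k') ->
  \forall p' \near p, c' (f p') ^+ k' - c' (f p) ^+ k' =
    d%:R * (c p' ^+ k - c p ^+ k).
Proof.
move=> ac ac' cp c'p tc tc'; have [fc fholo] := fh.
have hc := rs_chart ac; have hc' := rs_chart ac'.
have [co _ _ _] := hc; have [co' _ _ _] := hc'.
have [g [fg dg]] := fholo c c' p ac ac' cp c'p.
pose F (w : C) : C := g w ^+ k' - d%:R * w ^+ k.
have dF : \forall w \near c p, is_derive (w : C) (1 : C) F 0.
  (* The equation of forms is used at all points near [p], so the local expression [g] must be valid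
     around each of them. *)
  have W1 : \forall p' \near p, \forall p'' \near p', (c' \o f) p'' = g (c p'').
    exact: nbhs_interior fg.
  have W2 : \forall p' \near p, chart_dom c' (f p').
    by apply: (fc p); apply: open_nbhs_nbhs.
  apply: filterS (filterI dg (chart_image_nbhs hc cp (filterI W1 W2))) => w.
  move=> [dgw [p' [cp' [W1p' W2p'] cw]]].
  have D : deriv_in c (c' \o f) p' ('D_1 g w).
    by exists g; rewrite cw; split=> //; exact: derivableP.
  have := fp ac ac' cp' W2p' D.
  rewrite (form_root_chart ac tc cp') (form_root_chart ac' tc' W2p').
  have -> : c' (f p') = g w by rewrite -cw; exact: (nbhs_singleton W1p').
  rewrite cw; have := derivableP dgw; move: ('D_1 g w) => D1 dg1 E.
  have dn : (d%:R : R[i]) != 0 by rewrite pnatr_eq0 -lt0n.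
  have E2 : k'%:R * g w ^+ k'.-1 * D1 = d%:R * (k%:R * w ^+ k.-1).
    by rewrite E mulVKf.
  have dgX := @is_deriveX _ _ g k' w 1 _ dg1.
  have dX := @is_deriveX _ _ (id : C -> C) k w 1 1 (is_derive_id _ _).
  have dZ := @is_deriveZ _ _ _ _ (d%:R : R[i]) _ _ _ dX.
  have dB := @is_deriveB _ _ _ _ _ _ _ _ _ dgX dZ.
  suff E3 : (k'%:R * g w ^+ k'.-1 : R[i]) *: D1 -
      (d%:R : R[i]) *: ((k%:R * w ^+ k.-1 : R[i]) *: (1 : C)) = 0.
    apply: near_eq_is_derive (is_derive_eq dB E3).
    by near=> z; rewrite /F !fctE.
  rewrite /GRing.scale /=; apply/eqP; rewrite subr_eq0; apply/eqP.
  by rewrite E2 [in RHS]mulr1.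
have := chart_preimage_nbhs hc cp (locally_constant dF).
have E : (c' \o f) p = g (c p) by exact: (nbhs_singleton fg).
apply: filterS2 fg => p' /= E' [_]; rewrite /F -E' -E /=.
by move=> /subr_swap ->; rewrite mulrBr.
Unshelve. all: by end_near. Qed.

End LocalForm.

Section NearLemmas.
Variables (R : realType) (X : local_model_surface R).
Local Notation C := ((R[i])^o).

Lemma near_rightI x y P Q : near_right X x y P -> near_right X x y Q ->
  near_right X x y (fun x' y' => P x' y' /\ Q x' y').
Proof.
case=> e1 e10 H1 [e2 e20 H2]; exists (Num.min e1 e2); first by rewrite lt_min
  e10.
move=> x' y'; rewrite lt_min -ltrBlDl lt_min => /andP[xx' /andP[h1 h2]].
by move=> /andP[h3 h4] vy'; split; [apply: H1|apply: H2] => //; lra.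
Qed.

Lemma near_leftI x y P Q : near_left X x y P -> near_left X x y Q ->
  near_left X x y (fun x' y' => P x' y' /\ Q x' y').
Proof.
case=> e1 e10 H1 [e2 e20 H2]; exists (Num.min e1 e2); first by rewrite lt_min
  e10.
move=> x' y'; rewrite lt_min ltrBlDl -ltrBlDr lt_min => /andP[/andP[h1 h2] xx'].
by move=> /andP[h3 h4] vy'; split; [apply: H1|apply: H2] => //; lra.
Qed.

Lemma near_rightS x y (P Q : R -> R -> Prop) :
  (forall x' y', valid X y' -> P x' y' -> Q x' y') ->
  near_right X x y P -> near_right X x y Q.
Proof. by move=> PQ [e e0 H]; exists e => // x' y' ? ? v; apply: PQ => //;
  exact: H. Qed.

Lemma near_leftS x y (P Q : R -> R -> Prop) :
  (forall x' y', valid X y' -> P x' y' -> Q x' y') ->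
  near_left X x y P -> near_left X x y Q.
Proof. by move=> PQ [e e0 H]; exists e => // x' y' ? ? v; apply: PQ => //;
  exact: H. Qed.

Lemma nbhs_near_right (A : set X) x y : valid X y -> nbhs (unroll X x y) A ->
  near_right X x y (fun x' y' => A (unroll X x' y')).
Proof.
move=> vy; rewrite nbhsE => -[B [Bo Bx] BA].
have [H _] := proj1 (open_unroll B) Bo.
by apply: near_rightS (H x y vy Bx) => x' y' _; exact: BA.
Qed.

Lemma nbhs_near_left (A : set X) x y : valid X y -> nbhs (unroll_left X x y) A
  ->
  near_left X x y (fun x' y' => A (unroll_left X x' y')).
Proof.
move=> vy; rewrite nbhsE => -[B [Bo Bx] BA].
have [_ H] := proj1 (open_unroll B) Bo.
by apply: near_leftS (H x y vy Bx) => x' y' _; exact: BA.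
Qed.

Lemma valid_height (p : X) : valid X (height p).
Proof. by have [x [y [vy ->]]] := unroll_surj p; rewrite height_unroll. Qed.

Lemma Im_sub (a b : C) : complex.Im (a - b) = complex.Im a - complex.Im b.
Proof. by case: a b => ? ? []. Qed.

(** On one-sided boxes the imaginary part of the flat coordinate and the height change by the same
    amount, so the set where the two differences agree is open. *)
Lemma height_coordinate (c : chart R X) (k : nat) p : rs_atlas c ->
  chart_dom c p ->
  translation_coordinate (@lms_proj R X) (chart_dom c) (fun p => c p ^+ k) ->
  \forall p' \near p, complex.Im (c p' ^+ k - c p ^+ k) = height p' - height p.
Proof.
move=> ac cp /translation_unroll[tr tl]; have [co _ _ _] := rs_chart ac.
pose A := [set p' | chart_dom c p' /\
  complex.Im (c p' ^+ k) - complex.Im (c p ^+ k) = height p' - height p].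
have Ao : open A.
  have [dr dl] := proj1 (open_unroll (chart_dom c)) co.
  apply/open_unroll; split=> x y vy [dx E].
    apply: near_rightS (near_rightI (dr x y vy dx) (tr x y vy dx)).
    move=> x' y' vy' [dx' H]; split=> //.
    move: E; rewrite !height_unroll // => E.
    by have := congr1 (@complex.Im R) H; rewrite Im_sub /=; lra.
  apply: near_leftS (near_leftI (dl x y vy dx) (tl x y vy dx)).
  move=> x' y' vy' [dx' H]; split=> //.
  move: E; rewrite !height_unroll_left // => E.
  by have := congr1 (@complex.Im R) H; rewrite Im_sub /=; lra.
have : nbhs p A by apply: open_nbhs_nbhs; split=> //; split=> //; rewrite
  !subrr.
by apply: filterS => p' [_ <-]; rewrite Im_sub.
Qed.

End NearLemmas.

(** * Regular points and unique continuation *)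

Section RegularPoints.
Variables (R : realType) (X : local_model_surface R).
Local Notation C := ((R[i])^o).
Local Notation D := (lms_rect X).
Local Notation c0 := (c0 D).
Local Notation valid := (valid X).
Local Notation unroll := (unroll X).
Local Notation unroll_left := (unroll_left X).

(** A small box around such a point is not cut by the unrolling. Height [c0] is excluded over the
    nodes, where cone points may lie. *)
Definition regular (x y : R) : Prop := c0 < y \/ ~ is_node D x.

Lemma unroll_left_eq x y : valid y -> regular x y -> unroll_left x y = unroll x
  y.
Proof.
by move=> vy [/ltW y0|nx]; [rewrite unroll_left_above|rewrite
  unroll_left_regular].
Qed.

Lemma regular_near x y : regular x y -> exists2 e : R, 0 < e &
  forall x' y', `|x' - x| < e -> `|y' - y| < e -> regular x' y'.
Proof.
case=> [y0|nx].
  exists (y - c0) => [|x' y' _]; first by rewrite subr_gt0.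
  by rewrite ltr_norml => ?; left; lra_real.
have [e e0 He] := not_node_near D x; exists e => // x' y' x'x _; right.
by have [->//|/eqP x'x'] := eqVneq x' x; exact: He.
Qed.

Lemma unroll_left_inj a b x y : valid b -> valid y -> regular x y ->
  unroll_left a b = unroll x y -> eqmod x a /\ y = b.
Proof.
move=> vb vy reg E.
have reg' : y <> c0 \/ ~ is_node D x by case: reg; [left=> ?; lra_real|right].
have yb : y = b by rewrite -(height_unroll x vy) -E height_unroll_left.
split=> //; move: E; case: (ltP b c0) => b0; last first.
  by rewrite unroll_left_above // => /esym /(unroll_inj vy vb reg')[].
rewrite unroll_left_below //; last exact: ltW.
move=> /esym /(unroll_inj vy vb reg')[xa _].
have nx : ~ is_node D x by case: reg => // ?; lra_real.
have na : ~ is_node D a.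
  by move=> /is_node_next/(is_node_eqmod (eqmod_sym xa)).
apply: eqmod_trans xa _; rewrite next_regular //.
by exists 1; rewrite mul1r subrK.
Qed.

(** The translation laws on the two sides of the vertical line combine on a full box; its image [N]
    is open, and there the flat coordinate recovers the position in the box. *)
Lemma regular_chart x y (c : chart R X) (k : nat) :
  valid y -> regular x y -> chart_dom c (unroll x y) ->
  translation_coordinate (@lms_proj R X) (chart_dom c) (fun p => c p ^+ k) ->
  exists2 e : R, 0 < e & exists N : set X, [/\ nbhs (unroll x y) N,
    forall p p', N p -> N p' -> c p ^+ k = c p' ^+ k -> p = p' &
    forall x' y', `|x' - x| < e -> `|y' - y| < e ->
      c (unroll x' y') ^+ k - c (unroll x y) ^+ k = (x' - x) +i* (y' - y)].
Proof.
move=> vy reg cp /translation_unroll[tr tl].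
have [e1 e10 He1] := valid_near vy; have [e2 e20 He2] := regular_near reg.
have [e3 e30 He3] := tr x y vy cp.
have [|e4 e40 He4] := tl x y vy; first by rewrite unroll_left_eq.
pose e := Num.min (Num.min e1 e2) (Num.min e3 e4).
have [l1 l2 l3 l4] : [/\ e <= e1, e <= e2, e <= e3 & e <= e4].
  by split; rewrite /e !ge_min lexx ?orbT.
have e0 : 0 < e by rewrite !lt_min e10 e20 e30.
have box_val y' : `|y' - y| < e -> valid y' by move=> y'y; apply: He1; lra_real.
have box_reg x' y' : `|x' - x| < e -> `|y' - y| < e -> regular x' y'.
  by move=> x'x y'y; apply: He2; lra_real.
have zeta x' y' : `|x' - x| < e -> `|y' - y| < e ->
    c (unroll x' y') ^+ k - c (unroll x y) ^+ k = (x' - x) +i* (y' - y).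
  move=> x'x y'y; have := x'x; rewrite ltr_norml => x'x'.
  case: (leP x x') => xx'.
    by apply: He3; [lra_real|lra_real|exact: box_val].
  rewrite -(unroll_left_eq vy reg) -(unroll_left_eq _ (box_reg _ _ x'x y'y)).
    by apply: He4; [lra_real|lra_real|exact: box_val].
  exact: box_val.
exists e => //.
exists [set p | exists x' y', [/\ `|x' - x| < e, `|y' - y| < e & p = unroll x'
  y']].
split=> //; last first.
  move=> _ _ [x1 [y1 [x1x y1y ->]]] [x2 [y2 [x2x y2y ->]]] E.
  by have := zeta _ _ x1x y1y; rewrite E zeta // => -[/addIr -> /addIr ->].
apply: open_nbhs_nbhs; split; last by exists x, y; rewrite !subrr normr0.
apply/open_unroll; split=> a b vb [x1 [y1 [x1x y1y E]]].
  have reg1 := box_reg _ _ x1x y1y.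
  have [|[k' ax] yb] := @unroll_inj _ _ x1 y1 a b (box_val _ y1y) vb _ (esym E).
    by case: reg1; [left=> ?; lra_real|right].
  exists (Num.min (e - `|x1 - x|) (e - `|y1 - y|)); first by rewrite lt_min;
    lra_real.
  move=> x' y' /andP[ax']; rewrite -ltrBlDl !lt_min => /andP[h1 _] /andP[_ h2]
    vy'.
  (* Subtracting the period that separates [a] from [x1] brings the point back into the box. *)
  exists (x' - k'%:~R * (2 * pi)), y'; split.
  - have -> : x' - k'%:~R * (2 * pi) - x = (x' - a) + (x1 - x) by rewrite ax;
    ring.
    by apply: le_lt_trans (ler_normD _ _) _; rewrite ger0_norm; lra_real.
  - have -> : y' - y = (y' - b) + (y1 - y) by rewrite yb; ring.
    by apply: le_lt_trans (ler_normD _ _) _; lra_real.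
  by apply: unroll_eqmod; exists (- k'); rewrite rmorphN /=; ring.
have reg1 := box_reg _ _ x1x y1y.
have [[k' ax] yb] := unroll_left_inj vb (box_val _ y1y) reg1 E.
exists (Num.min (e - `|x1 - x|) (e - `|y1 - y|)); first by rewrite lt_min;
  lra_real.
move=> x' y' /andP[]; rewrite ltrBlDl -ltrBlDr !lt_min => /andP[h1 _] ax'.
move=> /andP[_ h2] vy'.
have bx : `|x' - k'%:~R * (2 * pi) - x| < e.
  have -> : x' - k'%:~R * (2 * pi) - x = (x' - a) + (x1 - x) by rewrite ax;
    ring.
  by apply: le_lt_trans (ler_normD _ _) _; rewrite ler0_norm; lra_real.
have byy : `|y' - y| < e.
  have -> : y' - y = (y' - b) + (y1 - y) by rewrite yb; ring.
  by apply: le_lt_trans (ler_normD _ _) _; lra_real.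
exists (x' - k'%:~R * (2 * pi)), y'; split=> //.
rewrite -(unroll_left_eq vy' (box_reg _ _ bx byy)).
by apply: unroll_left_eqmod; exists (- k'); rewrite rmorphN /=; ring.
Qed.

(** The parameters where [u] and [v] agree form a closed subset of [S] since the surface is
    Hausdorff, and an open one since near such a parameter both paths have the same value of an
    injective coordinate [z]. *)
Lemma unique_continuation (S : set R) (u v : R -> X) : is_interval S ->
  {within S, continuous u} -> {within S, continuous v} ->
  (forall r, S r -> u r = v r -> exists (z : X -> C) (N : set X) (e : R),
     [/\ nbhs (u r) N, forall p p', N p -> N p' -> z p = z p' -> p = p', 0 < e &
         forall r', S r' -> `|r' - r| < e -> z (u r') = z (v r')]) ->
  forall r0, S r0 -> u r0 = v r0 -> forall r, S r -> u r = v r.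
Proof.
move=> Si uc vc H r0 S0 E0.
have near_path (w : R -> X) (wc : {within S, continuous w}) r (A : set X) : S r
  -> nbhs (w r) A ->
    exists2 e : R, 0 < e & forall r', S r' -> `|r' - r| < e -> A (w r').
  move=> Sr Ar; move/subspace_continuousP: wc => wc.
  have /nbhsRP[e e0 He] := wc r Sr A Ar.
  by exists e => // r' Sr' r'r; exact: He.
pose B := [set r | S r /\ u r = v r].
suff -> : S = B by move=> r [].
have /connected_intervalP Sc := Si; symmetry; apply: Sc; first by exists r0.
  exists (interior [set r | S r -> u r = v r]); first exact: open_interior.
  apply/seteqP; split=> r [Sr E]; split=> //; last exact: (interior_subset E).
  have [z [N [e [Nr zN e0 He]]]] := H r Sr E.
  have [e1 e10 He1] := near_path u uc r N Sr Nr.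
  rewrite E in Nr; have [e2 e20 He2] := near_path v vc r N Sr Nr.
  apply/nbhsRP; exists (Num.min e (Num.min e1 e2)); first by rewrite !lt_min e0
    e10.
  move=> r'; rewrite !lt_min => /andP[h /andP[h1 h2]] Sr'.
  by apply: zN; [exact: He1|exact: He2|exact: He].
exists (closure B); first exact: closed_closure.
apply/seteqP; split=> r [Sr Br]; split=> //; first by apply: subset_closure.
apply: (@rs_hausdorff R X) => A A' Ar Ar'.
have [e1 e10 He1] := near_path u uc r A Sr Ar.
have [e2 e20 He2] := near_path v vc r A' Sr Ar'.
have [|r' [[Sr' E] /= h]] := Br [set r' | `|r' - r| < Num.min e1 e2].
  by apply/nbhsRP; exists (Num.min e1 e2); rewrite ?lt_min ?e10.
move: h; rewrite lt_min => /andP[h1 h2].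
by exists (u r'); split; [exact: He1|rewrite E; exact: He2].
Qed.

End RegularPoints.

(** * Local model maps are affine on the strip *)

Section LocalModelMaps.
Variables (R : realType) (Y X : local_model_surface R) (d : nat) (f : Y -> X).
Local Notation C := ((R[i])^o).
Local Notation tau := (2 * pi : R).
Local Notation cX := (c0 (lms_rect X)).
Local Notation cY := (c0 (lms_rect Y)).
Hypothesis hf : local_model_map d f.

(** The point [y] lies in one of the disks over [f y], and the exponent of that disk is positive. *)
Lemma degree_gt0 : (0 < d)%N.
Proof.
have [[_ fc] _ _] := hf; set y := unroll Y 0 cY.
have [c [r [m [b [rho [k [[_ cy _ _] hb fE _ <-]]]]]]] := fc (f y).
have : (f @^-1` chart_dom c) y by [].
rewrite fE => -[j _ _]; have [_ _ _ kj _] := hb j.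
by rewrite (bigD1 j) //= addn_gt0 kj.
Qed.

(** As the degree is positive there is a disk over [x], and its center is sent to [x]. *)
Lemma map_surj (x : X) : exists y, f y = x.
Proof.
have [[_ fc] _ _] := hf; have [c [r [m [b [rho [k [[hc cx cx0 _] hb fE _
  kd]]]]]]] := fc x.
case: m b rho k hb fE kd => [|m] b rho k hb fE kd.
  by have := degree_gt0; rewrite -kd big_ord0.
have [_ bE rho0 k0 bk] := hb ord0.
have [y by_ y0] : (b ord0 @` chart_dom (b ord0)) 0.
  by rewrite bE /disk /= normr0 ltcR.
exists y; have cfy : chart_dom c (f y).
  suff : (f @^-1` chart_dom c) y by [].
  by rewrite fE; exists ord0.
have [[_ cinj _ _] _] := hc; apply: cinj; rewrite ?inE //.
by rewrite cx0 bk // y0 expr0n /= eqn0Ngt k0.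
Qed.

Lemma map_continuous : continuous f.
Proof. by have [[[]]] := hf. Qed.

Local Notation hgt y := (cX + d%:R * (y - cY)).

Lemma Im_natM (a : C) : complex.Im (d%:R * a) = d%:R * complex.Im a.
Proof.
rewrite -(rmorph_nat (real_complex R)); case: a => a b /=.
by rewrite mul0r addr0.
Qed.

Lemma natM_complex (a b : R) : (d%:R : C) * (a +i* b) = (d%:R * a) +i* (d%:R *
  b).
Proof.
rewrite -(rmorph_nat (real_complex R)); apply/eqP; rewrite eq_complex /=.
by rewrite !mul0r subr0 addr0 !eqxx.
Qed.

Lemma map_local p (c : chart R Y) (c' : chart R X) (k k' : nat) :
  rs_atlas c -> rs_atlas c' -> chart_dom c p -> chart_dom c' (f p) ->
  translation_coordinate (@lms_proj R Y) (chart_dom c) (fun p => c p ^+ k) ->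
  translation_coordinate (@lms_proj R X) (chart_dom c') (fun p => c' p ^+ k') ->
  \forall p' \near p, c' (f p') ^+ k' - c' (f p) ^+ k' =
    d%:R * (c p' ^+ k - c p ^+ k).
Proof. have [[fh _] fp _] := hf; exact: (local_form degree_gt0 fh fp). Qed.

Lemma map_right x y (c' : chart R X) (k' : nat) :
  valid Y y -> rs_atlas c' -> chart_dom c' (f (unroll Y x y)) ->
  translation_coordinate (@lms_proj R X) (chart_dom c') (fun p => c' p ^+ k') ->
  near_right Y x y (fun x' y' =>
    c' (f (unroll Y x' y')) ^+ k' - c' (f (unroll Y x y)) ^+ k' =
      (d%:R * (x' - x)) +i* (d%:R * (y' - y))).
Proof.
move=> vy ac' c'p tc'; have [c [k [ac cp _ _ tc]]] := root_chart_at (unroll Y x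
  y).
have H := nbhs_near_right vy (map_local ac ac' cp c'p tc tc').
move/translation_unroll: tc => [/(_ x y vy cp) tr _].
apply: near_rightS (near_rightI H tr) => x' y' vy' [-> ->].
exact: natM_complex.
Qed.

Lemma map_left x y (c' : chart R X) (k' : nat) :
  valid Y y -> rs_atlas c' -> chart_dom c' (f (unroll_left Y x y)) ->
  translation_coordinate (@lms_proj R X) (chart_dom c') (fun p => c' p ^+ k') ->
  near_left Y x y (fun x' y' =>
    c' (f (unroll_left Y x' y')) ^+ k' - c' (f (unroll_left Y x y)) ^+ k' =
      (d%:R * (x' - x)) +i* (d%:R * (y' - y))).
Proof.
move=> vy ac' c'p tc'.
have [c [k [ac cp _ _ tc]]] := root_chart_at (unroll_left Y x y).
have H := nbhs_near_left vy (map_local ac ac' cp c'p tc tc').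
move/translation_unroll: tc => [_ /(_ x y vy cp) tl].
apply: near_leftS (near_leftI H tl) => x' y' vy' [-> ->].
exact: natM_complex.
Qed.

(** By the local form, the height of [f p] minus [d] times the height of [p] is locally constant,
    hence constant on the connected surface; the central leaves give the constant. *)
Lemma height_map p : height (f p) = hgt (height p).
Proof.
pose H p := height (f p) - d%:R * height p.
have loc p0 : \forall p' \near p0, H p' = H p0.
  have [c [k [ac cp _ _ tc]]] := root_chart_at p0.
  have [c' [k' [ac' c'p _ _ tc']]] := root_chart_at (f p0).
  have h1 := map_local ac ac' cp c'p tc tc'.
  have h2 := height_coordinate ac cp tc.
  have h3 := map_continuous (height_coordinate ac' c'p tc').
  apply: filterS (filterI h1 (filterI h2 h3)) => p' [e1 [e2 e3]].
  move: e3; rewrite /= e1 Im_natM e2 /H; lra_real.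
have Ho (P : R -> Prop) : open [set q | P (H q)].
  by rewrite openE => q Pq; apply: filterS (loc q) => q' /= ->.
have Hc q : H q = H p.
  suff : [set: Y] `<=` [set q | H q = H p] by apply.
  have /(_ [set q | H q = H p]) Yc := @rs_connected R Y.
  rewrite Yc //; first by exists p.
    by exists [set q | H q = H p]; [exact: (Ho (fun r => r = H p))|rewrite
      setTI].
  exists [set q | H q = H p]; rewrite ?setTI // -[X in closed X]setCK.
  by apply: open_closedC; exact: (Ho (fun r => r <> H p)).
have [y0 yc] : exists y0 : Y, central_leaf y0.
  by exists (unroll Y 0 cY); apply/central_leafE; rewrite height_unroll //;
    exact: valid_c0.
have fyc : central_leaf (f y0) by have [_ _ <-] := hf; exists y0.
move/central_leafE: yc => yc; move/central_leafE: fyc => fyc.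
have := Hc y0; rewrite /H yc fyc; lra_real.
Qed.

Lemma valid_map y : valid Y y -> valid X (hgt y).
Proof.
by move=> vy; rewrite -(height_unroll 0 vy) -height_map; exact: valid_height.
Qed.

Lemma valid_map_surj y' : valid X y' -> exists2 y, valid Y y & y' = hgt y.
Proof.
move=> vy'; have [p fp] := map_surj (unroll X 0 y').
by exists (height p); [exact: valid_height|rewrite -height_map fp
  height_unroll].
Qed.

Lemma dR_gt0 : 0 < (d%:R : R).
Proof. by rewrite ltr0n degree_gt0. Qed.

Lemma within_map (S : set R) (w : R -> Y) : {within S, continuous w} ->
  {within S, continuous (f \o w)}.
Proof.
move=> /subspace_continuousP wc; apply/subspace_continuousP => r Sr.
by apply: cvg_comp (wc r Sr) _; exact: map_continuous.
Qed.

(** Above the central leaf every point is regular, so the continuation runs along the whole line. *)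
Lemma map_horizontal b y0 : valid Y y0 -> cY < y0 ->
  f (unroll Y 0 y0) = unroll X b (hgt y0) ->
  forall x, f (unroll Y x y0) = unroll X (d%:R * x + b) (hgt y0).
Proof.
move=> vy0 y0c E x; have dR := dR_gt0.
have hc : cX < hgt y0 by rewrite ltrDl mulr_gt0 // subr_gt0.
have vh := valid_map vy0.
have uE r : unroll_left Y r y0 = unroll Y r y0 by rewrite unroll_left_above //
  ltW.
apply: (@unique_continuation _ X setT (f \o unroll Y ^~ y0)
  (fun x => unroll X (d%:R * x + b) (hgt y0)) _ _ _ _ 0) => //.
- by apply: within_map; apply: continuous_horizontal => // r _; right; left;
  exact: ltW.
- apply: (continuous_unroll (u := fun x => d%:R * x + b) (v := fun=> hgt y0)
    (K := d%:R)) => //.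
  + move=> r r'; have -> : d%:R * r' + b - (d%:R * r + b) = d%:R * (r' - r) by
    ring.
    by rewrite normrM ger0_norm // ltW.
  + by move=> r r'; rewrite subrr normr0 mulr_ge0 // ltW.
  move=> r _; exists 1 => // r' _ _; case: (leVlt r r') => rr'.
    by left; split=> //; rewrite lerD2r ler_pM2l.
  by right; split; rewrite ?unroll_left_above ?(ltW hc) // lerD2r ler_pM2l //
    ltW.
- move=> r _ /= Er.
  have [c [k [ac cp _ _ tc]]] := root_chart_at (unroll X (d%:R * r + b) (hgt
    y0)).
  have reg : regular X (d%:R * r + b) (hgt y0) by left.
  have [e e0 [N [Np Ninj zN]]] := regular_chart vh reg cp tc.
  have cp' := cp; rewrite -Er in cp'.
  have [e1 e10 H1] := map_right vy0 ac cp' tc.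
  have cp2 := cp'; rewrite -uE in cp2.
  have [e2 e20 H2] := map_left vy0 ac cp2 tc.
  (* The target point moves [d] times as fast, so a box of size [e] allows parameters up to
     [e / d]. *)
  exists (fun p => c p ^+ k), N, (Num.min (e / d%:R) (Num.min e1 e2)).
  split=> //; [by rewrite Er|by rewrite !lt_min divr_gt0 //= e10|].
  move=> r' _; rewrite !lt_min ltr_pdivlMr // => /andP[h /andP[h1 h2]].
  apply: (addIr (- c (f (unroll Y r y0)) ^+ k)).
  have zr : c (f (unroll Y r' y0)) ^+ k - c (f (unroll Y r y0)) ^+ k =
      (d%:R * (r' - r)) +i* (d%:R * (y0 - y0)).
    case: (leVlt r r') => rr'.
      by apply: H1; rewrite ?subrr ?normr0 //; rewrite ltr_norml in h1;
        lra_real.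
    rewrite -!uE; apply: H2; rewrite ?subrr ?normr0 //.
    by rewrite ltr_norml in h2; lra_real.
  rewrite /= in Er; rewrite /= zr Er zN; last by rewrite subrr normr0.
    by congr (_ +i* _); ring.
  have -> : d%:R * r' + b - (d%:R * r + b) = (r' - r) * d%:R by ring.
  by rewrite normrM [`|d%:R|]ger0_norm // ltW.
- by rewrite mulr0 add0r.
Qed.

(** Only the image line has to avoid the nodes: in the source a vertical path is continuous even
    over a node, and its points are compared through [map_right] alone. *)
Lemma map_vertical x b y0 : valid Y y0 -> ~ is_node (lms_rect X) (d%:R * x + b)
  ->
  f (unroll Y x y0) = unroll X (d%:R * x + b) (hgt y0) ->
  forall y, valid Y y -> f (unroll Y x y) = unroll X (d%:R * x + b) (hgt y).
Proof.
move=> vy0 nx E y vy; have dR := dR_gt0.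
have hgtB r r' : hgt r' - hgt r = d%:R * (r' - r) by ring.
apply: (@unique_continuation _ X (valid Y) (f \o unroll Y x)
  (fun y => unroll X (d%:R * x + b) (hgt y)) _ _ _ _ y0) => //.
- by move=> a a' va va' z; exact: valid_between.
- by apply: within_map; exact: continuous_vertical.
- apply: (continuous_unroll (u := fun=> d%:R * x + b) (v := fun y => hgt y)
    (K := d%:R)) => //.
  + by move=> r r'; rewrite subrr normr0 mulr_ge0 // ltW.
  + by move=> r r'; rewrite hgtB normrM ger0_norm // ltW.
  + by move=> r; exact: valid_map.
  by move=> r _; exists 1 => // r' _ _; left.
move=> r vr /= Er.
have [c [k [ac cp _ _ tc]]] := root_chart_at (unroll X (d%:R * x + b) (hgt r)).
have reg : regular X (d%:R * x + b) (hgt r) by right.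
have [e e0 [N [Np Ninj zN]]] := regular_chart (valid_map vr) reg cp tc.
have cp' := cp; rewrite -Er in cp'.
have [e1 e10 H1] := map_right vr ac cp' tc.
exists (fun p => c p ^+ k), N, (Num.min (e / d%:R) e1).
split=> //; [by rewrite Er|by rewrite !lt_min divr_gt0|].
move=> r' vr'; rewrite !lt_min ltr_pdivlMr // => /andP[h h1].
apply: (addIr (- c (f (unroll Y x r)) ^+ k)).
have zr : c (f (unroll Y x r')) ^+ k - c (f (unroll Y x r)) ^+ k =
    (d%:R * (x - x)) +i* (d%:R * (r' - r)).
  by apply: H1 => //; lra_real.
rewrite zr Er zN ?subrr ?normr0 ?mulr0 ?hgtB //.
by rewrite normrM ger0_norm ?ltW // mulrC.
Qed.

Lemma map_unroll : exists b, forall x y, valid Y y ->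
  f (unroll Y x y) = unroll X (d%:R * x + b) (hgt y) /\
  f (unroll_left Y x y) = unroll_left X (d%:R * x + b) (hgt y).
Proof.
have dR := dR_gt0.
have [e0 e00 He0] := valid_near (valid_c0 Y).
pose y0 := cY + e0 / 2.
have vy0 : valid Y y0.
  by apply: He0; rewrite /y0 addrC addKr gtr0_norm; lra_real.
have y0c : cY < y0 by rewrite /y0; lra_real.
have [b [y1 [vy1 E]]] := unroll_surj (f (unroll Y 0 y0)).
have y1E : y1 = hgt y0 by rewrite -(height_unroll b vy1) -E height_map
  height_unroll.
rewrite y1E in E; exists b => x y vy.
(* For generic abscissas, start on a horizontal line above the leaf and continue vertically. *)
have generic x' : ~ is_node (lms_rect X) (d%:R * x' + b) ->
    f (unroll Y x' y) = unroll X (d%:R * x' + b) (hgt y).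
  by move=> nx; apply: (map_vertical vy0 nx) => //; exact: map_horizontal.
have [eX eX0 HeX] := not_node_near (lms_rect X) (d%:R * x + b).
have [eY eY0 HeY] := not_node_near (lms_rect Y) x.
have vh := valid_map vy.
(* The remaining abscissas are one-sided limits of generic ones, and limits are unique in a
   Hausdorff space. *)
split; apply: (@rs_hausdorff R X) => A A' Ap A'p.
  have [e1 e10 H1] := nbhs_near_right vy (map_continuous Ap).
  have [e2 e20 H2] := nbhs_near_right vh A'p.
  pose h := Num.min e1 (Num.min (e2 / d%:R) (eX / d%:R)) / 2.
  have hm : 0 < Num.min e1 (Num.min (e2 / d%:R) (eX / d%:R)).
    by rewrite !lt_min e10 !divr_gt0.
  have h0 : 0 < h by rewrite divr_gt0.
  have : h < Num.min e1 (Num.min (e2 / d%:R) (eX / d%:R)) by rewrite /h;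
    lra_real.
  rewrite !lt_min !ltr_pdivlMr // => /andP[he1 /andP[he2 heX]].
  have hd : 0 < h * d%:R by rewrite mulr_gt0.
  have xE : d%:R * (x + h) + b = d%:R * x + b + h * d%:R by ring.
  exists (f (unroll Y (x + h) y)); split.
    by apply: H1; rewrite ?subrr ?normr0 //; lra_real.
  rewrite generic xE.
    by apply: H2; rewrite ?subrr ?normr0 //; lra_real.
  by apply: HeX; [rewrite addrAC subrr add0r gtr0_norm|move=> ?; lra_real].
have [e1 e10 H1] := nbhs_near_left vy (map_continuous Ap).
have [e2 e20 H2] := nbhs_near_left vh A'p.
(* [eY] also keeps [x - h] off the nodes of [Y], so that [unroll_left] can be replaced with [unroll]
   there. *)
pose h := Num.min (Num.min e1 eY) (Num.min (e2 / d%:R) (eX / d%:R)) / 2.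
have hm : 0 < Num.min (Num.min e1 eY) (Num.min (e2 / d%:R) (eX / d%:R)).
  by rewrite !lt_min e10 !divr_gt0 ?eY0.
have h0 : 0 < h by rewrite divr_gt0.
have : h < Num.min (Num.min e1 eY) (Num.min (e2 / d%:R) (eX / d%:R)).
  by rewrite /h; lra_real.
rewrite !lt_min !ltr_pdivlMr // => /andP[/andP[he1 heY] /andP[he2 heX]].
have hd : 0 < h * d%:R by rewrite mulr_gt0.
have xE : d%:R * (x - h) + b = d%:R * x + b - h * d%:R by ring.
exists (f (unroll_left Y (x - h) y)); split.
  by apply: H1; rewrite ?subrr ?normr0 //; lra_real.
have nX : ~ is_node (lms_rect X) (d%:R * (x - h) + b).
  rewrite xE; apply: HeX => [|?]; last lra_real.
  by rewrite addrAC subrr add0r normrN gtr0_norm.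
rewrite unroll_left_regular; last first.
  apply: HeY => [|?]; last lra_real.
  by rewrite addrAC subrr add0r normrN gtr0_norm.
rewrite generic // -unroll_left_regular // xE.
by apply: H2; rewrite ?subrr ?normr0 //; lra_real.
Qed.

End LocalModelMaps.

(** * The source and the degree determine the target *)

Section Determination.
Variable R : realType.
Implicit Types X Y : local_model_surface R.
Local Notation tau := (2 * pi : R).

(** Apply [f] to the gluing of the left side of [x] with the right side of [next Y x]. The height is
    taken strictly below the central leaf, where [unroll] is injective up to periods. *)
Lemma next_map Y X (d : nat) (f : Y -> X) (b : R) : local_model_map d f ->
  (forall x y, valid Y y ->
    f (unroll Y x y) = unroll X (d%:R * x + b)
      (c0 (lms_rect X) + d%:R * (y - c0 (lms_rect Y))) /\
    f (unroll_left Y x y) = unroll_left X (d%:R * x + b)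
      (c0 (lms_rect X) + d%:R * (y - c0 (lms_rect Y)))) ->
  forall x, eqmod (next X (d%:R * x + b)) (d%:R * next Y x + b).
Proof.
move=> hf fE x; have dR := dR_gt0 hf.
have [e e0 He] := valid_near (valid_c0 Y).
set y := c0 (lms_rect Y) - e / 2.
have vy : valid Y y.
  by apply: He; rewrite /y addrC addKr normrN gtr0_norm; lra.
have yc : y < c0 (lms_rect Y) by rewrite /y; lra.
have vh := valid_map hf vy.
have hc : c0 (lms_rect X) + d%:R * (y - c0 (lms_rect Y)) < c0 (lms_rect X).
  by rewrite gtrDl pmulr_rlt0 // subr_lt0.
have := unroll_left_below x vy (ltW yc); move/(congr1 f).
have [_ ->] := fE x y vy; have [-> _] := fE (next Y x) y vy.
rewrite unroll_left_below //; last exact: ltW.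
by case/(unroll_inj vh vh); first by left=> E; rewrite E ltxx in hc.
Qed.

Lemma map_determined Y X Y' X' (d : nat)
    (f : Y -> X) (f' : Y' -> X') (beta : Y -> Y') :
  local_model_map d f -> local_model_map d f' -> isomorphism beta ->
  exists alpha : X -> X', isomorphism alpha /\
    forall y, f' (beta y) = alpha (f y).
Proof.
move=> hf hf' hb; have dR := dR_gt0 hf.
have [b fE] := map_unroll hf; have [b' fE'] := map_unroll hf'.
have [t bE] := map_unroll hb.
(* The point over [u] goes to [d u + b] in one target and to [d (u + t) + b'] in the other; [theta]
   is the difference. *)
pose theta := d%:R * t + b' - b.
have ok : shiftable X X' theta.
  split=> [y|x].
    (* The maps are onto, so each valid height of either target comes from a height of [Y], and both
       targets rescale it by [d]. *)
    split=> vy.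
      have [z vz ->] := valid_map_surj hf vy.
      have := valid_map hf' (valid_map hb vz); congr (valid X' _); ring.
    have [z' vz' E] := valid_map_surj hf' vy.
    have [z vz E'] := valid_map_surj hb vz'.
    have := valid_map hf vz; congr (valid X _); move: E; rewrite E'; lra.
  (* Both sides lie in the same window of length [tau], so congruence is enough. *)
  apply: (@lift_uniq R (x + theta)).
  - exact: next_itv.
  - by have := next_itv X x; lra.
  (* Every [x] is of the form [d u + b], so [next] on the target is read off from [next] at [u] on
     the source. *)
  pose u := (x - b) / d%:R.
  have xE : x = d%:R * u + b by rewrite /u mulrC divfK ?subrK // gt_eqF.
  have E1 : x + theta = d%:R * (1%:R * u + t) + b' by rewrite /theta xE; ring.
  rewrite E1; apply: eqmod_trans (next_map hf' fE' _) _.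
  have := eqmodD b' (eqmodMn d (next_map hb bE u)) => /eqmod_trans; apply.
  rewrite xE; apply: eqmod_trans (eqmodD theta (eqmod_sym (next_map hf fE u))).
  rewrite (_ : _ + theta = d%:R * (1%:R * next Y u + t) + b') //.
    exact: eqmod_refl.
  by rewrite /theta; ring.
have [alpha ha] := shift_ex ok; exists alpha; split.
  exact: shift_isomorphism ok ha.
move=> p; have [x [y [vy ->]]] := unroll_surj p.
have [-> _] := bE x y vy; have [-> _] := fE' (1%:R * x + t) _ (valid_map hb vy).
have [-> _] := fE x y vy; have [-> _] := ha (d%:R * x + b) _ (valid_map hf vy).
by congr (unroll X' _ _); rewrite /theta; ring.
Qed.

End Determination.

Theorem theorem2p1 (R : realType) :
  (forall (X X' : local_model_surface R) (L L' : finite_lamination R),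
     associated_lamination X L -> associated_lamination X' L' ->
     lamination_equiv L L' ->
     outer_height X = outer_height X' ->
     inner_height X = inner_height X' ->
     exists alpha : X -> X', isomorphism alpha)
  /\
  (forall (Y X Y' X' : local_model_surface R) (d : nat)
          (f : Y -> X) (f' : Y' -> X') (beta : Y -> Y'),
     local_model_map d f -> local_model_map d f' -> isomorphism beta ->
     exists alpha : X -> X', isomorphism alpha /\
       forall y : Y, f' (beta y) = alpha (f y)).
Proof.
split=> [X X' L L'|Y X Y' X' d f f' beta].
  exact: lamination_isomorphism.
exact: map_determined.
Qed.
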